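(* Any $f\in L^{0}(\mathbb{T})$ can be decomposed in an almost everywhere convergent series $$f(t)=\sum_{n\in\mathbb{Z}}c(n)e^{int}$$ whose negative part $f_{-}(t)=\sum_{n<0}c(n)e^{int}$ converges uniformly on $\mathbb{T}$. Further, the negative part can be taken to have arbitrarily small $U(\mathbb{T})$ norm; that is, for every $\epsilon>0$ the series can be chosen so that in addition $\|f_{-}\|_{U(\mathbb{T})}<\epsilon$.
   Context: $\mathbb{T}=\mathbb{R}/2\pi\mathbb{Z}$ is the circle. $L^{0}(\mathbb{T})$ is the space of (Lebesgue) measurable functions $f:\mathbb{T}\to\mathbb{C}$. A series $\sum_{n\in\mathbb{Z}}c(n)e^{int}$ with complex coefficients converges at $t$ if its partial sums $\sum_{|n|\le N}c(n)e^{int}$ converge as $N\to\infty$. The $U$-norm of a function $F$ is $$\|F\|_{U(\mathbb{T})}:=\sup_{N\geq0}\Big\Vert\sum_{n=-N}^{N}\widehat{F}(n)e^{int}\Big\Vert_{\infty},$$ where $\widehat{F}(n)$ are the Fourier coefficients of $F$ and $\|\cdot\|_\infty$ is the sup norm on $\mathbb{T}$. *)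

(* Defs.v *)
From HB Require Import structures.
From mathcomp Require Import all_boot all_order all_algebra.
From mathcomp Require Import all_classical all_reals all_analysis.
From mathcomp Require Import complex.

Set Implicit Arguments.
Unset Strict Implicit.
Unset Printing Implicit Defensive.

Import Order.TTheory GRing.Theory Num.Theory.
Import numFieldNormedType.Exports.

Local Open Scope classical_set_scope.
Local Open Scope ring_scope.

(* Functions on the circle R/2piZ are 2pi-periodic functions on R.  Complex
   values are typed in R[i]^o because the library puts the topology of a
   numeric field F that is not a variable on the regular module F^o; its norm
   is the modulus. *)

(* R with the Lebesgue (completed Borel) sigma-algebra, the domain of
   completed_lebesgue_measure. *)
Notation lebesgueType R := (caratheodory_type ((@wlength R idfun)^*)%mu).

Definition lebesgue_measurable_fun (R : realType) (f : R -> R[i]^o) : Prop :=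
  measurable_fun [set: lebesgueType R] (fun t : lebesgueType R => complex.Re (f t)) /\
  measurable_fun [set: lebesgueType R] (fun t : lebesgueType R => complex.Im (f t)).

Definition expi (R : realType) (n : int) (t : R) : R[i]^o :=
  Complex (cos (n%:~R * t)) (sin (n%:~R * t)).

(* \sum_(|n| <= N) c n * e^(int); the index n is k - N. *)
Definition trig_partial_sum (R : realType) (c : int -> R[i]^o) (N : nat)
    (t : R) : R[i]^o :=
  \sum_(k < N.*2.+1) c (k%:Z - N%:Z) * expi (k%:Z - N%:Z) t.

Definition negative_part (R : realType) (c : int -> R[i]^o) (n : int) :
    R[i]^o :=
  if (n < 0)%R then c n else 0.

(* The Lebesgue integral of a complex function is taken componentwise. *)
Definition fourier_coef (R : realType) (F : R -> R[i]^o) (n : int) : R[i]^o :=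
  (Complex ((pi *+ 2)^-1) 0) *
  Complex
    (\int[completed_lebesgue_measure]_(t in `[0, pi *+ 2])
        complex.Re (F t * expi (- n) t))
    (\int[completed_lebesgue_measure]_(t in `[0, pi *+ 2])
        complex.Im (F t * expi (- n) t)).

Definition sup_norm (R : realType) (F : R -> R[i]^o) : \bar R :=
  ereal_sup [set (Normc.normc (F t))%:E | t in [set: R]].

Definition U_norm (R : realType) (F : R -> R[i]^o) : \bar R :=
  ereal_sup [set sup_norm (trig_partial_sum (fourier_coef F) N)
            | N in [set: nat]].

(* Main.v *)
(* The series is a sum of blocks [Q * phi], where [Q] approximates in measure the
   current remainder and [phi] is a trigonometric polynomial close to [1] off a
   small set, with vanishing mean, tiny coefficients and bounded partial sums; the
   tiny coefficients make the partial sums of [Q * phi] almost equal to [Q] times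
   those of [phi].  A factor [phi] is obtained from a multiplier [F] with
   [F^(0) = 0] and [F] close to [1] off a small arc, as [sum_i chi_i(t) F(n_i t)]
   for a partition of unity [chi_i] by bumps of Wiener norm at most [1] and a
   lacunary sequence [n_i].

   Two multipliers are used.  The Menshov multiplier, [1] minus a normalised bump,
   has a Wiener norm [B] depending only on the size of the exceptional arc, but
   its negative part is as large as [B].  The analytic multiplier has no negative
   frequencies, but its norm is uncontrolled.  At each step the remainder is at
   most [e] off a small set: the part below [e] is corrected by the Menshov
   multiplier, which costs a negative part of size [B e], summable over the steps;
   the part above [e] is corrected by the analytic multiplier, whose large partial
   sums are confined to the exceptional sets.  Borel-Cantelli concludes. *)

Require Import Defs.
From HB Require Import structures.
From mathcomp Require Import all_boot all_order all_algebra.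
From mathcomp Require Import all_classical all_reals all_analysis.
From mathcomp Require Import complex.
From mathcomp Require Import measurable_realfun.
From mathcomp Require Import ring lra zify.

Set Implicit Arguments.
Unset Strict Implicit.
Unset Printing Implicit Defensive.

Import Order.TTheory GRing.Theory Num.Theory.
Import numFieldNormedType.Exports.

Local Open Scope classical_set_scope.
Local Open Scope ring_scope.

(** Taking the negative part is not bounded in the sup norm, so negative parts are controlled
    through Wiener norms. A multiplier of mean zero that is close to [1] off an arc of length about
    [1 / L] has values of size about [L] on that arc, so its Wiener norm is at least of order [L].
    Correcting a remainder of size [e] thus costs [L e] in the negative part and [1 / L] in measure;
    with [L] growing like [2 ^ k] and [e] decaying like [8 ^ - k], both costs are summable. This
    needs a remainder that is already small, which fails for [f] itself and on the earlier
    exceptional sets. There the analytic multiplier acts. Off a small set the remainder entering the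
    next step is below the threshold, so the part given to the analytic multiplier vanishes, and its
    approximant is chosen small after the norm of that multiplier is known. Functions are handled
    through their coefficients, products being finite convolutions; integrals appear only to
    identify the Fourier coefficients of the limit of the negative part. *)

Section Modulus.
Variable R : realType.
Local Notation C := R[i].

Definition nc (z : C) : R := Normc.normc z.

Lemma nc_ge0 z : 0 <= nc z.
Proof. by case: z => a b; rewrite /nc /= sqrtr_ge0. Qed.

Lemma ncD x y : nc (x + y) <= nc x + nc y.
Proof. exact: le_normcD. Qed.

Lemma ncM x y : nc (x * y) = nc x * nc y.
Proof. exact: Normc.normcM. Qed.

Lemma ncN x : nc (- x) = nc x.
Proof. exact: normcN. Qed.

Lemma nc0 : nc 0 = 0.
Proof. exact: Normc.normc0. Qed.

Lemma nc1 : nc 1 = 1.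
Proof. exact: Normc.normc1. Qed.

Lemma nc_eq0 x : nc x = 0 -> x = 0.
Proof. exact: Normc.eq0_normc. Qed.

Lemma ncB x y : nc (x - y) <= nc x + nc y.
Proof. by rewrite -[nc y]ncN ncD. Qed.

Lemma nc_distC x y : nc (x - y) = nc (y - x).
Proof. by rewrite -ncN opprB. Qed.

Lemma nc_dist_trans y x z : nc (x - z) <= nc (x - y) + nc (y - z).
Proof. by rewrite -[x - z](subrKA y) ncD. Qed.

Lemma ncX x n : nc (x ^+ n) = nc x ^+ n.
Proof. by elim: n => [|n IH]; rewrite ?expr0 ?nc1// !exprS ncM IH. Qed.

Lemma ncR (x : R) : nc x%:C%C = `|x|.
Proof. by rewrite /nc /= expr0n /= addr0 sqrtr_sqr. Qed.

Lemma nc_sqr (x : C) : nc x ^+ 2 = complex.Re x ^+ 2 + complex.Im x ^+ 2.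
Proof. by case: x => a b; rewrite /nc /= sqr_sqrtr // addr_ge0 // sqr_ge0. Qed.

Lemma nc_Re x : `|complex.Re x| <= nc x.
Proof.
rewrite -(@ler_pXn2r _ 2) // ?nnegrE ?nc_ge0 // nc_sqr real_normK ?num_real //.
by rewrite lerDl sqr_ge0.
Qed.

Lemma nc_Im x : `|complex.Im x| <= nc x.
Proof.
rewrite -(@ler_pXn2r _ 2) // ?nnegrE ?nc_ge0 // nc_sqr real_normK ?num_real //.
by rewrite lerDr sqr_ge0.
Qed.

Lemma nc_le_ReIm x : nc x <= `|complex.Re x| + `|complex.Im x|.
Proof.
rewrite -(@ler_pXn2r _ 2) // ?nnegrE ?nc_ge0 ?addr_ge0 // nc_sqr.
by rewrite sqrrD !real_normK ?num_real // addrAC lerDl mulrn_wge0 // mulr_ge0.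
Qed.

Lemma nc_sum I (r : seq I) (P : pred I) (F : I -> C) :
  nc (\sum_(i <- r | P i) F i) <= \sum_(i <- r | P i) nc (F i).
Proof.
apply: (big_ind2 (fun x y => nc x <= y)) => //; first by rewrite nc0.
by move=> x1 x2 y1 y2 h1 h2; apply: le_trans (ncD _ _) _; exact: lerD.
Qed.

Lemma ncnat n : nc n%:R = n%:R.
Proof. by rewrite -(rmorph_nat (real_complex R)) ncR ger0_norm. Qed.

End Modulus.

Arguments nc {R} z.

(** * Characters of the circle *)

Section Exponentials.
Variable R : realType.
Local Notation C := R[i].

Definition ex (n : int) (t : R) : C :=
  Complex (cos (n%:~R * t)) (sin (n%:~R * t)).

Lemma nc_ex n t : nc (ex n t) = 1.
Proof. by rewrite /nc /= cos2Dsin2 sqrtr1. Qed.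

Lemma exD n m t : ex (n + m) t = ex n t * ex m t.
Proof. by rewrite /ex rmorphD mulrDl cosD sinD /= [RHS]/GRing.mul /=; congr Complex; ring. Qed.

Lemma exDr n t s : ex n (t + s) = ex n t * ex n s.
Proof. by rewrite /ex mulrDr cosD sinD /= [RHS]/GRing.mul /=; congr Complex; ring. Qed.

Lemma ex0 t : ex 0 t = 1.
Proof. by rewrite /ex mul0r cos0 sin0. Qed.

Lemma ex0r n : ex n 0 = 1.
Proof. by rewrite /ex mulr0 cos0 sin0. Qed.

Lemma exM n m t : ex (n * m) t = ex n (m%:~R * t).
Proof. by rewrite /ex rmorphM mulrA. Qed.

Lemma exN n t : ex (- n) t = (ex n t)^*%C.
Proof. by rewrite /ex rmorphN mulNr cosN sinN. Qed.

Lemma exNr n t : ex n (- t) = ex (- n) t.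
Proof. by rewrite /ex mulrN rmorphN mulNr. Qed.

Lemma ex_nat n t : ex n%:Z t = ex 1 t ^+ n.
Proof.
elim: n => [|n IH]; first by rewrite ex0 expr0.
by rewrite -addn1 PoszD exD IH exprD expr1.
Qed.

Lemma ex_pi2 (p : int) : ex p (pi *+ 2) = 1.
Proof.
have h n : ex (Posz n) (pi *+ 2) = 1.
  by rewrite ex_nat /ex mul1r cos2pi sin2pi expr1n.
by case: p => n; rewrite ?h // NegzE exN h rmorph1.
Qed.

Lemma ex_periodic n t (p : int) : ex n (t + p%:~R * (pi *+ 2)) = ex n t.
Proof. by rewrite exDr -exM ex_pi2 mulr1. Qed.

End Exponentials.

(** * Symmetric sums, their shifts, and Wiener norms *)

Section SymmetricSums.

Section Generic.
Variable V : zmodType.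
Implicit Types (G : int -> V) (l : nat).

(** The index [k - l] is the one of [trig_partial_sum], which makes [psum] below convertible to
    it. *)
Definition ssum G l : V := \sum_(k < l.*2.+1) G (k%:Z - l%:Z).

Lemma ssum0 G : ssum G 0 = G 0.
Proof. by rewrite /ssum big_ord1. Qed.

Lemma ssumS G l :
  ssum G l.+1 = G (- l.+1%:Z) + ssum G l + G l.+1%:Z.
Proof.
rewrite /ssum doubleS big_ord_recr big_ord_recl /= sub0r; congr (_ + _ + G _).
  by apply: eq_bigr => k _; congr (G _); rewrite /bump /=; lia.
by lia.
Qed.

Lemma eq_ssum G H l :
  (forall n, (`|n| <= l)%N -> G n = H n) -> ssum G l = ssum H l.
Proof. by move=> GH; apply: eq_bigr => k _; apply: GH; have := ltn_ord k; lia. Qed.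

Lemma ssum_eq0 G l : (forall n, (`|n| <= l)%N -> G n = 0) -> ssum G l = 0.
Proof. by move=> G0; rewrite (eq_ssum G0) /ssum big1. Qed.

Lemma ssumD G H l : ssum (fun n => G n + H n) l = ssum G l + ssum H l.
Proof. exact: big_split. Qed.

Lemma ssumN G l : ssum (fun n => - G n) l = - ssum G l.
Proof. by rewrite /ssum sumrN. Qed.

Lemma ssum_sum I (r : seq I) (P : pred I) (F : I -> int -> V) l :
  ssum (fun n => \sum_(i <- r | P i) F i n) l = \sum_(i <- r | P i) ssum (F i) l.
Proof. by rewrite /ssum exchange_big. Qed.

Lemma exchange_ssum (F : int -> int -> V) l m :
  ssum (fun n => ssum (F n) m) l = ssum (fun k => ssum (F^~ k) l) m.
Proof. by rewrite /ssum exchange_big. Qed.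

Definition supp G (N : nat) := forall n, (N < `|n|)%N -> G n = 0.

Lemma supp_le G N M : (N <= M)%N -> supp G N -> supp G M.
Proof. by move=> NM GN n Mn; apply: GN; apply: leq_ltn_trans Mn. Qed.

Lemma ssum_supp G N l : supp G N -> (N <= l)%N -> ssum G l = ssum G N.
Proof.
move=> GN; elim: l => [|l IH]; first by rewrite leqn0 => /eqP ->.
rewrite leq_eqVlt => /predU1P[-> //|Nl].
by rewrite ssumS IH // !GN ?add0r ?addr0 //; lia.
Qed.

Lemma ssum_shift1 G l :
  ssum (fun n => G (n - 1)) l = ssum G l + (G (- l%:Z - 1) - G l%:Z).
Proof.
elim: l => [|l IH]; first by rewrite !ssum0 addrCA subrr addr0 sub0r.
rewrite !ssumS IH (_ : - l%:Z - 1 = - l.+1%:Z); last by lia.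
rewrite (_ : l.+1%:Z - 1 = l%:Z); last by lia.
set a := G _; set b := ssum _ _; set c := G _; set d := G _; set f := G _.
by rewrite -!addrA addNr addr0 (addrCA f) subrr addr0 addrC -addrA addrCA.
Qed.

End Generic.


Variable R : realType.
Local Notation C := R[i].
Implicit Types (c b : int -> C) (l N m : nat) (t B : R).

Lemma ssumMl (a : C) (G : int -> C) l : ssum (fun n => a * G n) l = a * ssum G l.
Proof. by rewrite /ssum mulr_sumr. Qed.

Lemma ssumRMl (a : R) (G : int -> R) l : ssum (fun n => a * G n) l = a * ssum G l.
Proof. by rewrite /ssum mulr_sumr. Qed.

Lemma ssumMr (a : C) (G : int -> C) l : ssum (fun n => G n * a) l = ssum G l * a.
Proof. by rewrite /ssum mulr_suml. Qed.

Lemma nc_ssum (G : int -> C) l : nc (ssum G l) <= ssum (nc \o G) l.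
Proof. exact: nc_sum. Qed.

Lemma ler_ssum (G H : int -> R) l : (forall n, (`|n| <= l)%N -> G n <= H n) ->
  ssum G l <= ssum H l.
Proof. by move=> GH; apply: ler_sum => k _; apply: GH; have := ltn_ord k; lia. Qed.

Lemma ssum_ge0 (G : int -> R) l : (forall n, 0 <= G n) -> 0 <= ssum G l.
Proof. by move=> G0; apply: sumr_ge0. Qed.

Lemma ssum_mono (G : int -> R) l m : (forall n, 0 <= G n) -> (l <= m)%N ->
  ssum G l <= ssum G m.
Proof.
move=> G0; elim: m => [|m IH]; first by rewrite leqn0 => /eqP ->.
rewrite leq_eqVlt => /predU1P[-> //|lm].
rewrite ssumS; apply: le_trans (IH lm) _.
by rewrite -addrA addrCA lerDl addr_ge0.
Qed.

Definition psum c l t : C := ssum (fun n => c n * ex n t) l.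

(** A bound on all partial sums expresses a Wiener norm at most [B] without a limit. *)
Definition wiener_le c B := forall l, ssum (nc \o c) l <= B.

Lemma wiener_le_ge0 c B : wiener_le c B -> 0 <= B.
Proof. by move=> /(_ 0%N); apply: le_trans; rewrite ssum_ge0 // => n; apply: nc_ge0. Qed.

Lemma psum_wiener c B l t : wiener_le c B -> nc (psum c l t) <= B.
Proof.
move=> cB; apply: le_trans (cB l); apply: le_trans (nc_ssum _ _) _.
by apply: ler_ssum => n _ /=; rewrite ncM nc_ex mulr1.
Qed.

Lemma wiener_exists c N : supp c N -> exists2 B, 0 <= B & wiener_le c B.
Proof.
move=> cN; exists (ssum (nc \o c) N); first by rewrite ssum_ge0 // => n; apply: nc_ge0.
have cN' : supp (nc \o c) N by move=> n /cN /= ->; rewrite nc0.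
move=> l; case: (leqP N l) => h; first by rewrite (ssum_supp cN' h).
by apply: ssum_mono (ltnW h) => n; apply: nc_ge0.
Qed.

Lemma psum_supp c N l t : supp c N -> (N <= l)%N -> psum c l t = psum c N t.
Proof. by move=> cN; apply: ssum_supp => n /cN ->; rewrite mul0r. Qed.

Lemma psumD c b l t : psum (fun n => c n + b n) l t = psum c l t + psum b l t.
Proof. by rewrite -ssumD; apply: eq_ssum => n _; rewrite mulrDl. Qed.

Lemma psumB c b l t : psum (fun n => c n - b n) l t = psum c l t - psum b l t.
Proof. by rewrite -ssumN -ssumD; apply: eq_ssum => n _; rewrite mulrBl. Qed.

Lemma psumMl a c l t : psum (fun n => a * c n) l t = a * psum c l t.
Proof. by rewrite -ssumMl; apply: eq_ssum => n _; rewrite mulrA. Qed.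

Lemma psum_sum I (r : seq I) (P : pred I) (F : I -> int -> C) l t :
  psum (fun n => \sum_(i <- r | P i) F i n) l t = \sum_(i <- r | P i) psum (F i) l t.
Proof. by rewrite -ssum_sum; apply: eq_ssum => n _; rewrite mulr_suml. Qed.

Lemma psum_eq0 c l t : (forall n, (`|n| <= l)%N -> c n = 0) -> psum c l t = 0.
Proof. by move=> c0; apply: ssum_eq0 => n /c0 ->; rewrite mul0r. Qed.

(** A shift by one changes only the two boundary terms, which costs [2 m]; iterate. *)
Lemma nc_ssum_shiftnat (G : int -> C) (m : R) l (k : nat) : (forall n, nc (G n) <= m) ->
  nc (ssum (fun n => G (n - k%:Z)) l - ssum G l) <= 2 * k%:R * m.
Proof.
move=> Gm; elim: k => [|k IH].
  by under eq_ssum do rewrite subr0; rewrite subrr nc0 mulr0 mul0r.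
have -> : ssum (fun n => G (n - k.+1%:Z)) l =
          ssum (fun n => (fun n => G (n - k%:Z)) (n - 1)) l.
  by apply: eq_ssum => n _; congr G; lia.
rewrite (ssum_shift1 (fun n => G (n - k%:Z))) addrAC.
apply: le_trans (ncD _ _) _.
rewrite -[k.+1]addn1 natrD mulrDr mulr1 mulrDl lerD //.
apply: le_trans (ncB _ _) _; rewrite mulr_natl mulr2n; exact: lerD.
Qed.

Lemma nc_ssum_shift (G : int -> C) (m : R) l (k : int) : (forall n, nc (G n) <= m) ->
  nc (ssum (fun n => G (n - k)) l - ssum G l) <= 2 * `|k|%:R * m.
Proof.
case: k => k Gm; first exact: nc_ssum_shiftnat.
(* A negative shift is the inverse of a positive one: the natural case is applied to the shifted
   sequence. *)
have := @nc_ssum_shiftnat (fun n => G (n - Negz k)) m l k.+1 (fun n => Gm _).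
rewrite nc_distC (_ : ssum (fun n => G (n - k.+1%:Z - Negz k)) l = ssum G l) //.
by apply: eq_ssum => n _; congr G; lia.
Qed.

Lemma ssum_shift_supp (V : zmodType) (G : int -> V) N l (k : int) :
  supp G N -> (N + `|k| <= l)%N -> ssum (fun n => G (n - k)) l = ssum G N.
Proof.
move=> GN; have h (k' : nat) H M m : supp H M -> (M + k' <= m)%N ->
    ssum (fun n => H (n - k'%:Z)) m = ssum H M :> V.
  move=> HM; elim: k' => [|k' IH] Mm.
    rewrite -(ssum_supp HM (l := m)); last by lia.
    by apply: eq_ssum => n _; rewrite subr0.
  have -> : ssum (fun n => H (n - k'.+1%:Z)) m =
            ssum (fun n => (fun n => H (n - k'%:Z)) (n - 1)) m.
    by apply: eq_ssum => n _; congr H; lia.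
  rewrite (ssum_shift1 (fun n => H (n - k'%:Z))) IH; last by lia.
  by rewrite !HM ?subrr ?addr0 //; lia.
case: k => k kl; first exact: h.
(* For a negative shift the shifted sequence is regarded as supported in a larger window and then
   shifted back. *)
have GkN : supp (fun n => G (n - Negz k)) (N + k.+1) by move=> n nN; apply: GN; lia.
rewrite (ssum_supp GkN) //.
rewrite -(h k.+1 _ _ (N + k.+1 + k.+1)%N GkN) //.
rewrite -(ssum_supp GN (l := (N + k.+1 + k.+1)%N)); last by lia.
by apply: eq_ssum => n _; congr G; lia.
Qed.

End SymmetricSums.

(** * Products of trigonometric polynomials as convolutions of coefficients *)

Section Convolution.
Variable R : realType.
Local Notation C := R[i].
Implicit Types (a b c : int -> C) (l N M : nat) (m n k : int) (t B : R).

(* Coefficients of [t |-> psum a N (m t) * b t]. *)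
Definition conv m a N b (n : int) : C := ssum (fun k => a k * b (n - k * m)) N.

Definition neg c n : C := if n < 0 then c n else 0.

Definition analytic c := forall n, n < 0 -> c n = 0.

(** Each frequency of [a] multiplies the sum of [b] over a shifted window. The exact and the
    approximate factorisation both compare these windows with the centred one. *)
Lemma psum_conv_expand m a N b l t :
  psum (conv m a N b) l t =
  ssum (fun k => a k * ex k (m%:~R * t) *
          ssum (fun n => b (n - k * m) * ex (n - k * m) t) l) N.
Proof.
transitivity (ssum (fun k => ssum (fun n => a k * b (n - k * m) * ex n t) l) N).
  rewrite -exchange_ssum; apply: eq_ssum => n _.
  by rewrite /conv -ssumMr.
apply: eq_ssum => k _; rewrite -ssumMl; apply: eq_ssum => n _.
have -> : ex n t = ex (n - k * m) t * ex (k * m) t by rewrite -exD subrK.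
by rewrite exM; ring.
Qed.

Lemma supp_conv m a N b M : supp b M -> supp (conv m a N b) (N * `|m| + M).
Proof.
move=> bM n nM; apply: ssum_eq0 => k kN; rewrite bM ?mulr0 //.
suff : (absz (k * m)%R <= N * `|m|)%N by lia.
by rewrite abszM leq_mul2r kN orbT.
Qed.

Lemma supp_mul_ex b M t : supp b M -> supp (fun n => b n * ex n t) M.
Proof. by move=> bM n /bM ->; rewrite mul0r. Qed.

Lemma psum_conv m a N b M l t : supp b M -> (N * `|m| + M <= l)%N ->
  psum (conv m a N b) l t = psum a N (m%:~R * t) * psum b M t.
Proof.
move=> bM Nl; rewrite psum_conv_expand /psum -ssumMr; apply: eq_ssum => k kN.
congr (_ * _); apply: (@ssum_shift_supp _ (fun n => b n * ex n t) M l (k * m) (supp_mul_ex _ bM)).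
apply: leq_trans Nl; rewrite addnC leq_add2r abszM.
by rewrite leq_mul2r kN orbT.
Qed.

Lemma wiener_conv m a N b M A B : supp b M -> wiener_le a A -> wiener_le b B ->
  wiener_le (conv m a N b) (A * B).
Proof.
(* The sums have nonnegative terms, so the window may be enlarged to [L], which contains every
   shifted copy of the support of [b]. *)
move=> bM aA bB l; set L := (l + N * `|m| + M)%N.
have B0 := wiener_le_ge0 bB.
have ncbM : supp (@nc R \o b) M by move=> n /bM /= ->; rewrite nc0.
apply: le_trans (ssum_mono (m := L) (fun n => nc_ge0 _) _) _; first by rewrite /L; lia.
apply: (@le_trans _ _ (ssum (fun n => ssum (fun k => nc (a k) * nc (b (n - k * m))) N) L)).
  apply: ler_ssum => n _; apply: le_trans (nc_ssum _ _) _.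
  by apply: ler_ssum => k _ /=; rewrite ncM.
rewrite exchange_ssum; apply: (@le_trans _ _ (ssum (fun k => B * nc (a k)) N)); last first.
  by rewrite ssumRMl mulrC ler_wpM2r.
apply: ler_ssum => k kN; rewrite ssumRMl mulrC.
rewrite ler_wpM2r ?nc_ge0 // (ssum_shift_supp ncbM) //.
have : (absz (k * m)%R <= N * `|m|)%N.
  by rewrite abszM leq_mul2r; apply/orP; right.
by rewrite /L; lia.
Qed.

Lemma conv_coef_le m a N b A (beta : R) n : wiener_le a A -> (forall n, nc (b n) <= beta) ->
  nc (conv m a N b n) <= A * beta.
Proof.
move=> aA bb; have b0 : 0 <= beta by apply: le_trans (bb 0); exact: nc_ge0.
apply: le_trans (nc_ssum _ _) _.
apply: (@le_trans _ _ (ssum (fun k => beta * nc (a k)) N)); last first.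
  by rewrite ssumRMl mulrC ler_wpM2r.
by apply: ler_ssum => k _ /=; rewrite ncM mulrC ler_wpM2r // nc_ge0.
Qed.

(* A partial sum of a product with a fixed polynomial almost factors when the
   coefficients of the other factor are small: a shift by [k] changes at most
   [2 |k|] terms. *)
Lemma psum_conv_approx a N b l t (beta : R) : (forall n, nc (b n) <= beta) ->
  nc (psum (conv 1 a N b) l t - psum a N t * psum b l t) <=
  ssum (fun k => nc (a k) * (2 * `|k|%:R)) N * beta.
Proof.
move=> bb; rewrite psum_conv_expand /psum -ssumMr -ssumN -ssumD.
apply: le_trans (nc_ssum _ _) _.
have -> (x : R) : ssum (fun k => nc (a k) * (2 * `|k|%:R)) N * x =
   ssum (fun k => nc (a k) * (2 * `|k|%:R * x)) N.
  by rewrite /ssum mulr_suml; apply: eq_bigr => k _; rewrite -!mulrA.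
apply: ler_ssum => k _ /=; rewrite mul1r -mulrBr !ncM nc_ex mulr1 ler_wpM2l ?nc_ge0 //.
have h := @nc_ssum_shift R (fun n => b n * ex n t) beta l (k * 1).
rewrite mulr1 in h *; apply: h => n.
by rewrite ncM nc_ex mulr1.
Qed.

Lemma neg_supp c N : supp c N -> supp (neg c) N.
Proof. by move=> cN n /cN; rewrite /neg; case: ifP. Qed.

Lemma wiener_neg c B : wiener_le c B -> wiener_le (neg c) B.
Proof.
move=> cB l; apply: le_trans (cB l); apply: ler_ssum => n _ /=.
by rewrite /neg; case: ifP => // _; rewrite nc0 nc_ge0.
Qed.

(** The frequency [k] of [a] produces a packet of radius [M] around [k m]. Since [M < m] and [k = 0]
    is absent, no packet meets both signs, so the sign of [k] decides. *)
Lemma neg_conv_dilate (m : nat) a N b M n : supp b M -> (M < m)%N -> a 0 = 0 ->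
  neg (conv m a N b) n = conv m (neg a) N b n.
Proof.
move=> bM Mm a0; rewrite /neg /conv; case: ifPn => n0.
  apply: eq_ssum => k _; case: ifPn => // k0.
  have [->|k1] := eqVneq k 0; first by rewrite a0 !mul0r.
  by rewrite bM ?mulr0 //; nia.
rewrite ssum_eq0 // => k _; case: ifPn => [k0|_]; last by rewrite mul0r.
by rewrite bM ?mulr0 //; nia.
Qed.

(** Here the second factor decides: its frequencies exceed [N] in modulus, and a shift by at most
    [N] cannot change their sign. *)
Lemma neg_conv a N b n : (forall n, (`|n| <= N)%N -> b n = 0) ->
  neg (conv 1 a N b) n = conv 1 a N (neg b) n.
Proof.
move=> b0; rewrite /neg /conv; case: ifPn => n0.
  apply: eq_ssum => k kN; rewrite mulr1; case: ifPn => // h.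
  by rewrite b0 //; lia.
rewrite ssum_eq0 // => k kN; rewrite mulr1; case: ifPn => h; last by rewrite mulr0.
by rewrite b0 ?mulr0 //; lia.
Qed.

Lemma analytic_neg c : analytic c -> forall n, neg c n = 0.
Proof. by move=> ca n; rewrite /neg; case: ifP => // /ca. Qed.

Lemma analytic_conv a N b : analytic a -> analytic b -> analytic (conv 1 a N b).
Proof.
move=> aa ba n n0; apply: ssum_eq0 => k _; rewrite mulr1.
have [k0|k0] := ltP k 0; first by rewrite aa // mul0r.
by rewrite ba ?mulr0 //; lia.
Qed.

Lemma analytic_conv0 a N b : analytic a -> analytic b -> conv 1 a N b 0 = a 0 * b 0.
Proof.
move=> aa ba; rewrite /conv (@ssum_supp _ _ 0%N) ?ssum0 ?mul0r ?subr0 // => n n0.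
rewrite mulr1 sub0r; have [k0|k0] := ltP n 0; first by rewrite aa // mul0r.
by rewrite ba ?mulr0 //; lia.
Qed.

Lemma conv_eq0 m a N b n : (forall k, (`|k| <= N)%N -> a k != 0 -> b (n - k * m) = 0) ->
  conv m a N b n = 0.
Proof.
move=> h; apply: ssum_eq0 => k kN; have [->|a0] := eqVneq (a k) 0; first by rewrite mul0r.
by rewrite h // mulr0.
Qed.

End Convolution.

(** * The Fejer kernel: decay and exact quadrature *)

Section Kernels.
Variable R : realType.
Local Notation C := R[i].
Local Notation tau := (pi *+ 2 : R).

Definition near2pi (t h : R) := exists p : int, `|t - p%:~R * tau| < h.

Lemma tau_gt0 : 0 < tau.
Proof. by rewrite mulrn_wgt0 // pi_gt0. Qed.

Lemma tau_neq0 : tau != 0.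
Proof. by rewrite gt_eqF // tau_gt0. Qed.

Lemma cos_le_far (s h : R) : 0 < h <= pi -> ~ near2pi s h -> cos s <= cos h.
Proof.
(* [p] is a nearest integer to [s / tau], so the residue [r] lies in [[-pi, pi]], where the cosine
   is monotone in the modulus. *)
move=> /andP[h0 hpi] far; set p := Num.floor (s / tau + 2^-1).
set r := s - p%:~R * tau.
have -> : cos s = cos r.
  have /(congr1 (@complex.Re R)) /= := ex_periodic 1 r p.
  by rewrite !mul1r subrK.
have rpi : `|r| <= pi.
  have := floor_itv (s / tau + 2^-1); rewrite -/p => /andP[p1 p2].
  have e : s = s / tau * tau by rewrite divfK // tau_neq0.
  rewrite ler_norml /r; apply/andP; split.
    move: p1; rewrite -lerBlDr -(ler_pM2r tau_gt0) -e; lra.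
  move: p2; rewrite intrD -ltrBrDr -(ltr_pM2r tau_gt0) -e.
  by move: tau_gt0; lra.
have hr : h <= `|r| by rewrite leNgt; apply/negP => rh; apply: far; exists p.
rewrite -(cos_norm r) leNgt; apply/negP => hcos.
move: hcos; rewrite ltr_cos ?in_itv /= ?normr_ge0 ?rpi ?(ltW h0) ?hpi //.
by rewrite ltNge hr.
Qed.

Lemma cos_lt1 (h : R) : 0 < h <= pi -> cos h < 1.
Proof.
move=> /andP[h0 hpi]; rewrite -cos0 ltr_cos // in_itv /= ?lexx ?pi_ge0 //.
by rewrite (ltW h0) hpi.
Qed.

(** One-sided, hence a plain geometric sum; its squared modulus divided by [m] is the Fejer kernel
    with mean [1]. *)
Definition dirichlet (m : nat) (s : R) : C := \sum_(u < m) ex u%:Z s.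

Definition fejer (m : nat) (s : R) : R := nc (dirichlet m s) ^+ 2 / m%:R.

Lemma fejer_ge0 m s : 0 <= fejer m s.
Proof. by rewrite /fejer divr_ge0 // sqr_ge0. Qed.

Lemma mul_conjc (z : C) : z * z^*%C = (nc z ^+ 2)%:C%C.
Proof. by case: z => a b; rewrite nc_sqr /= [LHS]/GRing.mul /=; congr Complex; ring. Qed.

Lemma fejerE m s : (fejer m s)%:C%C =
  m%:R^-1 * \sum_(u < m) \sum_(v < m) ex (u%:Z - v%:Z) s :> C.
Proof.
rewrite /fejer rmorphM fmorphV rmorph_nat mulrC /=. rewrite -mul_conjc; congr (_ * _).
rewrite /dirichlet rmorph_sum mulr_suml; apply: eq_bigr => u _.
by rewrite mulr_sumr; apply: eq_bigr => v _; rewrite exD exN.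
Qed.

Lemma dirichletE m s : (ex 1 s - 1) * dirichlet m s = ex m%:Z s - 1.
Proof.
rewrite /dirichlet ex_nat subrX1; congr (_ * _).
by apply: eq_bigr => i _; rewrite ex_nat.
Qed.

(** The geometric sum times [e^(is) - 1] has modulus at most [2], and the square of the modulus of
    [e^(is) - 1] is [2 - 2 cos s]. *)
Lemma fejer_far m (s h : R) : (0 < m)%N -> 0 < h <= pi -> ~ near2pi s h ->
  fejer m s <= 4 / (m%:R * (2 - 2 * cos h)).
Proof.
move=> m0 hpi far; have c1 := cos_le_far hpi far; have c2 := cos_lt1 hpi.
have nD : nc (ex 1 s - 1) ^+ 2 * nc (dirichlet m s) ^+ 2 <= 4.
  rewrite -exprMn -ncM dirichletE (_ : 4 = 2 ^+ 2); last by rewrite -natrX.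
  rewrite ler_pXn2r ?nnegrE ?nc_ge0 //.
  by apply: le_trans (ncB _ _) _; rewrite nc_ex nc1.
have n1 : nc (ex 1 s - 1) ^+ 2 = 2 - 2 * cos s.
  rewrite nc_sqr /= mul1r; have := cos2Dsin2 s; nra.
have mR : (0 : R) < m%:R by rewrite ltr0n.
rewrite /fejer ler_pdivlMr; last by rewrite mulr_gt0 //; lra.
rewrite mulrA divfK ?gt_eqF //; apply: le_trans nD.
by rewrite n1 mulrC ler_wpM2r ?sqr_ge0 //; lra.
Qed.

Lemma dirichlet_root m (p : int) : (0 < m)%N -> ~~ (m %| `|p|)%N ->
  dirichlet m (p%:~R * (tau / m%:R)) = 0.
Proof.
move=> m0 mp; have mR : (0 : R) < m%:R by rewrite ltr0n.
have m2 : (1 < m)%N by move: mp; case: m m0 {mR} => [|[|m]] //; rewrite dvd1n.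
set s := _ * _.
have hm : 0 < tau / m%:R <= pi.
  rewrite divr_gt0 ?tau_gt0 //= ler_pdivrMr // -[pi *+ 2]mulr_natr ler_wpM2l ?pi_ge0 //.
  by rewrite ler_nat.
have far : ~ near2pi s (tau / m%:R).
  move=> [q]; rewrite /s (_ : _ - _ = (p - q * m%:Z)%:~R * (tau / m%:R)); last first.
    by rewrite rmorphB rmorphM /= -pmulrn; field; rewrite gt_eqF.
  rewrite normrM (ger0_norm (x := tau / _)); last by case/andP: hm => /ltW.
  rewrite -ltr_pdivlMr; last by case/andP: hm.
  rewrite divff; last by case/andP: hm => /gt_eqF ->.
  rewrite -intr_norm ltrz1 => h.
  have pq : p = q * m%:Z by lia.
  by move/negP: mp; apply; rewrite pq abszM dvdn_mull.
have em : ex m%:Z s = 1.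
  by rewrite /s -exM mulrC exM mulrC -pmulrn divfK ?gt_eqF // ex_pi2.
have := dirichletE m s; rewrite em subrr => /eqP.
rewrite mulf_eq0 => /orP[|/eqP //]; rewrite subr_eq0 => /eqP e1.
have := le_lt_trans (cos_le_far hm far) (cos_lt1 hm).
have /(congr1 (@complex.Re R)) /= := e1; rewrite mul1r => ->.
by rewrite ltxx.
Qed.

(** The kernel has degree less than [m], so sampling at [m] equidistant points kills every frequency
    except [0]. *)
Lemma fejer_quadrature m (s : R) : (0 < m)%N ->
  \sum_(j < m) fejer m (s - j%:R * (tau / m%:R)) = m%:R.
Proof.
move=> m0; have mR : (m%:R : C) != 0 by rewrite pnatr_eq0 -lt0n.
apply: (@complexI R); rewrite rmorph_sum rmorph_nat /=.
under eq_bigr do rewrite fejerE.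
rewrite -mulr_sumr exchange_big /=.
apply: (mulfI mR); rewrite mulVKf //.
transitivity (\sum_(u < m) (m%:R : C)); last first.
  by rewrite sumr_const card_ord mulr_natr.
apply: eq_bigr => u _; rewrite exchange_big /= (bigD1 u) //= addrC big1 ?add0r.
  under eq_bigr do rewrite subrr ex0.
  by rewrite sumr_const card_ord.
move=> v vu; under eq_bigr do rewrite exDr.
rewrite -mulr_sumr (_ : \sum_(i < m) _ = dirichlet m ((v%:Z - u%:Z)%:~R * (tau / m%:R))).
  rewrite dirichlet_root ?mulr0 //; apply/negP => /dvdnP[k hk].
  move: vu; rewrite -val_eqE /=; have := ltn_ord u; have := ltn_ord v.
  by case: k hk => [|k] hk; nia.
apply: eq_bigr => j _; rewrite exNr opprB [j%:R]pmulrn -!exM.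
by rewrite mulrC.
Qed.

End Kernels.

(** * A partition of unity by translates of a positive definite bump *)

Section PartitionOfUnity.
Variable R : realType.
Local Notation C := R[i].
Local Notation tau := (pi *+ 2 : R).

Lemma ssum_delta (V : pzRingType) (g : int -> V) (k : int) (l : nat) : (`|k| <= l)%N ->
  ssum (fun n => (k == n)%:R * g n) l = g k.
Proof.
elim: l => [|l IH] kl; first by rewrite ssum0 (_ : k = 0) ?eqxx ?mul1r //; lia.
rewrite ssumS; have [kl'|kl'] := leqP `|k| l.
  have -> : (k == - l.+1%:Z) = false by apply/eqP; lia.
  have -> : (k == l.+1%:Z) = false by apply/eqP; lia.
  by rewrite !mul0r add0r addr0 IH.
rewrite ssum_eq0 ?addr0; last first.
  by move=> n nl; rewrite (_ : (k == n) = false) ?mul0r //; apply/eqP; lia.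
have [->|->] : k = - l.+1%:Z \/ k = l.+1%:Z by lia.
  by rewrite eqxx mul1r (_ : (_ == _) = false) ?mul0r ?addr0 //; apply/eqP; lia.
by rewrite eqxx mul1r (_ : (_ == _) = false) ?mul0r ?add0r //; apply/eqP; lia.
Qed.

Variables (L M : nat).
Hypotheses (L2 : (2 <= L)%N) (M0 : (0 < M)%N).
Local Notation m := (L * M)%N.

Let L0 : (0 < L)%N. Proof. exact: ltnW L2. Qed.
Let m0 : (0 < m)%N. Proof. by rewrite muln_gt0 L0. Qed.
Let mR : (0 : R) < m%:R. Proof. by rewrite ltr0n. Qed.
Let LR : (0 : R) < L%:R. Proof. by rewrite ltr0n. Qed.
Let MR : (0 : R) < M%:R. Proof. by rewrite ltr0n. Qed.

Definition fejer_coef (n : int) : R :=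
  m%:R^-1 * \sum_(u < m) \sum_(v < m) (u%:Z - v%:Z == n)%:R.

(** [hat_coef], its normalised squared modulus, is the transform of the autocorrelation of [M]
    consecutive grid points: a discrete hat, whose coefficients are therefore nonnegative. *)
Definition hat_sum (n : int) : C :=
  \sum_(x < M) ex (- n) (x%:R * (tau / m%:R)).

Definition hat_coef (n : int) : R := nc (hat_sum n) ^+ 2 / (m%:R * M%:R).

Definition chi_coef (n : int) : R := fejer_coef n * hat_coef n.

(* The hat function of width [tau / L], discretised with step [tau / m] and
   convolved with the Fejer kernel. *)
Definition chi (t : R) : R := (m%:R * M%:R)^-1 *
  \sum_(y < M) \sum_(x < M) fejer m (t - (x%:Z - y%:Z)%:~R * (tau / m%:R)).

Lemma fejer_coef_ge0 n : 0 <= fejer_coef n.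
Proof. by rewrite mulr_ge0 ?invr_ge0 ?(ltW mR) // sumr_ge0 // => u _; rewrite sumr_ge0. Qed.

Lemma hat_coef_ge0 n : 0 <= hat_coef n.
Proof. by rewrite divr_ge0 ?sqr_ge0 // mulr_ge0. Qed.

Lemma fejer_coef_le1 n : fejer_coef n <= 1.
Proof.
rewrite /fejer_coef mulrC ler_pdivrMr // mul1r.
rewrite -[leRHS](_ : \sum_(u < m) (1 : R) = _); last by rewrite sumr_const card_ord.
apply: ler_sum => u _.
have [/existsP[v0 /eqP h]|] := boolP [exists v : 'I_m, u%:Z - v%:Z == n].
  rewrite (bigD1 v0) //= h eqxx big1 ?addr0 // => v vv0.
  rewrite (_ : (_ == _) = false) //; apply/eqP => h'.
  by move/eqP: vv0; apply; apply/val_inj => /=; lia.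
by rewrite negb_exists => /forallP h; rewrite big1 // => v _; rewrite (negbTE (h v)).
Qed.

Lemma hat_coef_le n : hat_coef n <= L%:R^-1.
Proof.
rewrite /hat_coef ler_pdivrMr ?mulr_gt0 // natrM mulrA mulKf ?gt_eqF // -expr2.
rewrite ler_pXn2r ?nnegrE ?nc_ge0 //; apply: le_trans (nc_sum _ _ _) _.
by under eq_bigr do rewrite nc_ex; rewrite sumr_const card_ord.
Qed.

Lemma chi_coef_ge0 n : 0 <= chi_coef n.
Proof. by rewrite mulr_ge0 ?fejer_coef_ge0 ?hat_coef_ge0. Qed.

Lemma chi_coef_le n : chi_coef n <= L%:R^-1.
Proof.
rewrite -[leRHS]mul1r ler_pM ?fejer_coef_ge0 ?hat_coef_ge0 ?fejer_coef_le1 //.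
exact: hat_coef_le.
Qed.

Lemma hat_coefE n : (hat_coef n)%:C%C = (m%:R * M%:R)^-1 *
  \sum_(y < M) \sum_(x < M) ex (- n) ((x%:Z - y%:Z)%:~R * (tau / m%:R)) :> C.
Proof.
rewrite /hat_coef mulrC rmorphM /= -mul_conjc fmorphV rmorphM !rmorph_nat; congr (_ * _).
rewrite {2}/hat_sum rmorph_sum mulr_sumr; apply: eq_bigr => y _.
rewrite /hat_sum mulr_suml; apply: eq_bigr => x _.
by rewrite intrB mulrBl exDr exNr [ex (- - n) _]exN -!pmulrn.
Qed.

Lemma supp_chi : supp (fun n => (chi_coef n)%:C%C) m.
Proof.
move=> n nm; rewrite /chi_coef /fejer_coef big1 ?mulr0 ?mul0r // => u _.
rewrite big1 // => v _; rewrite (_ : (_ == _) = false) //; apply/eqP => h.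
by have := ltn_ord u; have := ltn_ord v; lia.
Qed.

Lemma psum_fejer l s : (m <= l)%N ->
  psum (fun n => (fejer_coef n)%:C%C) l s = (fejer m s)%:C%C.
Proof.
move=> ml; rewrite fejerE.
transitivity (ssum (fun n => \sum_(u < m) \sum_(v < m)
     m%:R^-1 * ((u%:Z - v%:Z == n)%:R * ex n s)) l).
  apply: eq_ssum => n _; rewrite /fejer_coef rmorphM fmorphV rmorph_nat /=.
  rewrite -!mulrA rmorph_sum mulr_suml mulr_sumr; apply: eq_bigr => u _.
  rewrite rmorph_sum mulr_suml mulr_sumr; apply: eq_bigr => v _.
  by rewrite rmorph_nat.
rewrite ssum_sum mulr_sumr; apply: eq_bigr => u _.
rewrite ssum_sum mulr_sumr; apply: eq_bigr => v _.
rewrite ssumMl (ssum_delta (fun n => ex n s)) //.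
by have := ltn_ord u; have := ltn_ord v; lia.
Qed.

Lemma psum_chi l t : (m <= l)%N -> psum (fun n => (chi_coef n)%:C%C) l t = (chi t)%:C%C.
Proof.
move=> ml; rewrite /chi rmorphM fmorphV rmorphM !rmorph_nat /= rmorph_sum mulr_sumr.
transitivity (ssum (fun n => \sum_(y < M) \sum_(x < M) (m%:R * M%:R)^-1 *
   ((fejer_coef n)%:C%C * ex n (t - (x%:Z - y%:Z)%:~R * (tau / m%:R)))) l).
  apply: eq_ssum => n _; rewrite /chi_coef rmorphM /= hat_coefE.
  rewrite -!mulrA mulr_suml mulrCA [X in _ * X]mulr_sumr mulr_sumr.
  apply: eq_bigr => y _; rewrite mulr_suml !mulr_sumr; apply: eq_bigr => x _.
  by rewrite exDr exNr [ex n t * _]mulrC.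
rewrite ssum_sum; apply: eq_bigr => y _.
rewrite ssum_sum rmorph_sum mulr_sumr; apply: eq_bigr => x _.
by rewrite ssumMl; congr (_ * _); exact: psum_fejer.
Qed.

Lemma chi_ge0 t : 0 <= chi t.
Proof.
rewrite mulr_ge0 ?invr_ge0 ?mulr_ge0 // sumr_ge0 // => y _.
by rewrite sumr_ge0 // => x _; apply: fejer_ge0.
Qed.

(** For fixed [y] the nodes [i M + x] run once through the grid of [m] points, so the quadrature
    formula gives [m]; the normalisation absorbs this and the sum over [y]. *)
Lemma chi_sum t : \sum_(i < L) chi (t - i%:R * (tau / L%:R)) = 1.
Proof.
rewrite /chi -mulr_sumr exchange_big /=.
rewrite (eq_bigr (fun=> m%:R)) => [|y _].
  rewrite sumr_const card_ord -[X in _ * X]mulr_natr mulVf // mulf_neq0 // gt_eqF //.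
rewrite -[RHS](fejer_quadrature (t + y%:R * (tau / m%:R)) m0).
rewrite -(big_mkord xpredT (fun j => fejer m (t + y%:R * (tau / m%:R) - j%:R * (tau / m%:R)))).
rewrite big_nat_mul big_mkord; apply: eq_bigr => i _.
rewrite -{1}[(i * M)%N]add0n big_addn mulSn addnK big_mkord; apply: eq_bigr => x _.
congr fejer; rewrite intrB natrD natrM -!pmulrn natrM; field.
by rewrite !gt_eqF.
Qed.

Lemma chi_le1 t : chi t <= 1.
Proof.
rewrite -(chi_sum t) -(prednK L0) big_ord_recl mul0r subr0 lerDl.
by rewrite sumr_ge0 // => i _; apply: chi_ge0.
Qed.

(** The coefficients are nonnegative, so the Wiener norm is the value at [0], at most [1] as a
    member of a partition of unity. *)
Lemma wiener_chi : wiener_le (fun n => (chi_coef n)%:C%C) 1.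
Proof.
move=> l; apply: le_trans (ssum_mono (m := maxn m l) (fun n => nc_ge0 _) _) _.
  exact: leq_maxr.
apply: le_trans (chi_le1 0); rewrite -lecR.
rewrite -(psum_chi (l := maxn m l)) ?leq_maxl //.
rewrite (@eq_ssum _ _ chi_coef) => [|n _]; last by rewrite [LHS]ncR ger0_norm ?chi_coef_ge0.
by rewrite /psum /ssum rmorph_sum ler_sum // => k _; rewrite ex0r mulr1.
Qed.

Lemma chi_coef0 : chi_coef 0 = L%:R^-1.
Proof.
have e1 : fejer_coef 0 = 1.
  rewrite /fejer_coef (eq_bigr (fun=> 1)) => [|u _].
    by rewrite sumr_const card_ord mulVf ?gt_eqF.
  rewrite (bigD1 u) //= subrr eqxx big1 ?addr0 // => v vu.
  rewrite (_ : (_ == _) = false) //; apply/eqP => h.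
  by move/eqP: vu; apply; apply/val_inj => /=; lia.
have e2 : hat_sum 0 = M%:R.
  rewrite /hat_sum; under eq_bigr do rewrite oppr0 ex0.
  by rewrite sumr_const card_ord.
rewrite /chi_coef e1 mul1r /hat_coef e2 ncnat natrM; field.
by rewrite !gt_eqF.
Qed.

Lemma chi_coefN n : chi_coef (- n) = chi_coef n.
Proof.
congr (_ * _).
  rewrite /fejer_coef exchange_big /=; congr (_ * _); apply: eq_bigr => v _.
  by apply: eq_bigr => u _; rewrite -(inj_eq (@oppr_inj _)) opprB opprK.
rewrite /hat_coef (_ : hat_sum (- n) = (hat_sum n)^*%C).
  by congr (_ ^+ 2 / _); case: (hat_sum n) => a b; rewrite /nc /= sqrrN.
by rewrite /hat_sum rmorph_sum; apply: eq_bigr => x _; rewrite exN.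
Qed.

(** The nodes lie within [M] grid steps, that is [tau / L], of the centre, so each Fejer kernel is
    still evaluated at distance at least [tau / L] from the period lattice. For fixed [L] the bound
    tends to [0] as [M] grows. *)
Lemma chi_far (t : R) : ~ near2pi t (tau / L%:R *+ 2) ->
  chi t <= 4 / (m%:R * (2 - 2 * cos (tau / L%:R))).
Proof.
move=> far; have hL : 0 < tau / L%:R <= pi.
  rewrite divr_gt0 ?tau_gt0 //= ler_pdivrMr // -[pi *+ 2]mulr_natr ler_wpM2l ?pi_ge0 //.
  by rewrite ler_nat.
set bnd := _ / _; have c1 := cos_lt1 hL.
have bnd0 : 0 <= bnd by rewrite divr_ge0 // mulr_ge0 //; lra.
apply: (@le_trans _ _ ((m%:R * M%:R)^-1 * \sum_(y < M) \sum_(x < M) bnd)).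
  rewrite ler_wpM2l ?invr_ge0 ?mulr_ge0 //; apply: ler_sum => y _; apply: ler_sum => x _.
  apply: fejer_far => // -[p hp]; apply: far; exists p.
  rewrite (_ : _ - _ = (t - (x%:Z - y%:Z)%:~R * (tau / m%:R) - p%:~R * tau) +
     (x%:Z - y%:Z)%:~R * (tau / m%:R)); last by ring.
  apply: le_lt_trans (ler_normD _ _) _; rewrite mulr2n ltr_leD //.
  rewrite normrM -intr_norm (ger0_norm (x := tau / _)); last first.
    by rewrite divr_ge0 ?(ltW (tau_gt0 R)).
  rewrite (_ : tau / L%:R = M%:R * (tau / m%:R)); last first.
    by rewrite natrM; field; rewrite !gt_eqF.
  rewrite ler_wpM2r ?divr_ge0 ?(ltW (tau_gt0 R)) // [M%:R]pmulrn ler_int.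
  by have := ltn_ord x; have := ltn_ord y; lia.
rewrite !sumr_const !card_ord -!mulrnA -[bnd *+ _]mulr_natr mulrC.
rewrite ler_pdivrMr ?mulr_gt0 // ler_wpM2l // -natrM ler_nat leq_mul2r.
by apply/orP; right; rewrite leq_pmull.
Qed.

End PartitionOfUnity.

(** * Bumps modulated by a multiplier at lacunary frequencies *)

Section LacunarySum.
Variable R : realType.
Local Notation C := R[i].
Local Notation tau := (pi *+ 2 : R).

(** The interface of [chi]. The discretisation parameter is hidden, and its freedom survives as a
    free choice of [tail] once [L] is fixed. *)
Record bump (L : nat) (tail : R) (c : int -> C) (N : nat) (X : R -> R) : Prop := Bump {
  bump_supp : supp c N;
  bump_wiener : wiener_le c 1;
  bump_coef n : nc (c n) <= L%:R^-1;
  bump_mean : c 0 = (L%:R^-1)%:C%C;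
  bump_conj n : c (- n) = (c n)^*%C;
  bump_val t : psum c N t = (X t)%:C%C;
  bump_ge0 t : 0 <= X t;
  bump_sum t : \sum_(i < L) X (t - i%:R * (tau / L%:R)) = 1;
  bump_far t : ~ near2pi t (tau / L%:R *+ 2) -> X t <= tail }.

Lemma bump_exists (L : nat) (tail : R) : (2 <= L)%N -> 0 < tail ->
  exists c N X, bump L tail c N X.
Proof.
move=> L2 tail0; have LR : (0 : R) < L%:R by rewrite ltr0n ltnW.
have hL : 0 < tau / L%:R <= pi.
  rewrite divr_gt0 ?tau_gt0 //= ler_pdivrMr // -[pi *+ 2]mulr_natr ler_wpM2l ?pi_ge0 //.
  by rewrite ler_nat.
have c1 := cos_lt1 hL; set w := 2 - 2 * cos (tau / L%:R).
have w0 : 0 < w by rewrite /w; lra.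
(* Makes the bound of [chi_far] at most [tail], since [L * M >= M]. *)
set M := (Num.truncn (4 / (w * tail))).+1.
have hM : 4 / (w * tail) < M%:R by rewrite truncnS_gt.
have M0 : (0 < M)%N by [].
exists (fun n => (chi_coef R L M n)%:C%C), (L * M)%N, (@chi R L M); split.
- exact: supp_chi.
- exact: wiener_chi.
- by move=> n; rewrite ncR ger0_norm ?chi_coef_ge0 // chi_coef_le.
- by rewrite chi_coef0.
- by move=> n; rewrite chi_coefN conjc_real.
- by move=> t; rewrite psum_chi.
- by move=> t; apply: chi_ge0.
- exact: chi_sum.
move=> t far; apply: le_trans (chi_far L2 M0 far) _; rewrite -/w.
rewrite ler_pdivrMr ?mulr_gt0 ?ltr0n ?muln_gt0 ?(ltnW L2) // natrM.
move: hM; rewrite ltr_pdivrMr ?mulr_gt0 // => /ltW /le_trans; apply.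
rewrite [leRHS](_ : _ = L%:R * (M%:R * (w * tail))); last by ring.
by rewrite ler_peMl ?(ler_nat _ 1) ?(ltnW L2) // !mulr_ge0 ?(ltW w0) ?(ltW tail0).
Qed.

Definition translate (c : int -> C) (a : R) (n : int) : C := c n * ex (- n) a.

Lemma psum_translate c a l t : psum (translate c a) l t = psum c l (t - a).
Proof.
apply: eq_ssum => n _; rewrite /translate exDr exNr; ring.
Qed.

Lemma wiener_translate c a B : wiener_le c B -> wiener_le (translate c a) B.
Proof.
move=> cB l; apply: le_trans (cB l); apply: ler_ssum => n _ /=.
by rewrite ncM nc_ex mulr1.
Qed.

Lemma supp_translate c a N : supp c N -> supp (translate c a) N.
Proof. by move=> cN n /cN; rewrite /translate => ->; rewrite mul0r. Qed.

Variables (L : nat) (tail : R) (c : int -> C) (N : nat) (X : R -> R).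
Hypothesis cX : bump L tail c N X.
Hypothesis L2 : (2 <= L)%N.
Variables (D N0 : nat).

(* [level i] bounds the frequencies of the pieces before the [i]-th; [freq i] is
   large enough for the [i]-th piece to have all its frequencies beyond. *)
Fixpoint level (i : nat) : nat :=
  if i is j.+1 then (D * (level j + N + L).+1 + N + level j)%N else N0.

Definition freq (i : nat) : nat := (level i + N + L).+1.

Definition piece (F : int -> C) (i : nat) : int -> C :=
  conv (freq i) F D (translate c (i%:R * (tau / L%:R))).

Definition lacunary (F : int -> C) (I : nat) (n : int) : C := \sum_(i < I) piece F i n.

Definition cell (i : nat) (t : R) : R := X (t - i%:R * (tau / L%:R)).

Lemma lacunaryS F I n : lacunary F I.+1 n = lacunary F I n + piece F I n.
Proof. by rewrite /lacunary big_ord_recr. Qed.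

Lemma level_ge i : (N0 <= level i)%N.
Proof. by elim: i => //= i IH; apply: leq_trans IH _; rewrite leq_addl. Qed.

(** As [F] has no mean, every frequency of the piece is within [N] of a nonzero multiple of
    [freq i], which exceeds [level i + N]. *)
Lemma piece_low F i n : F 0 = 0 -> (`|n| <= level i)%N -> piece F i n = 0.
Proof.
move=> F0 nM; apply: conv_eq0 => k kD Fk.
have k0 : k != 0 by apply: contraNneq Fk => ->; rewrite F0.
apply: (supp_translate _ (bump_supp cX)); rewrite /freq.
have : (freq i <= absz (k * (freq i)%:Z)%R)%N by rewrite abszM absz_nat leq_pmull // absz_gt0.
rewrite /freq; lia.
Qed.

Lemma piece_supp F i : supp (piece F i) (level i.+1).
Proof.
apply: supp_le (supp_conv (N := D) _ (supp_translate _ (bump_supp cX))).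
by rewrite /= leq_addr.
Qed.

Lemma lacunary_supp F I : supp (lacunary F I) (level I).
Proof.
elim: I => [|I IH] n nI; first by rewrite /lacunary big_ord0.
rewrite lacunaryS piece_supp // addr0 IH //; apply: leq_ltn_trans nI => /=.
by rewrite leq_addl.
Qed.

Lemma lacunary_low F I n : F 0 = 0 -> (`|n| <= N0)%N -> lacunary F I n = 0.
Proof.
move=> F0 nN; rewrite /lacunary big1 // => i _; apply: piece_low => //.
exact: leq_trans (level_ge i).
Qed.

Lemma psum_piece F i l t : (level i.+1 <= l)%N ->
  psum (piece F i) l t = psum F D ((freq i)%:R * t) * (cell i t)%:C%C.
Proof.
move=> il; rewrite /piece (@psum_conv _ _ _ _ _ N).
- by rewrite psum_translate (bump_val cX) -pmulrn.
- exact: supp_translate (bump_supp cX).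
- by apply: leq_trans il; rewrite /= leq_addr.
Qed.

Lemma psum_lacunary F I l t : (level I <= l)%N ->
  psum (lacunary F I) l t = \sum_(i < I) psum F D ((freq i)%:R * t) * (cell i t)%:C%C.
Proof.
move=> Il; rewrite psum_sum; apply: eq_bigr => i _; apply: psum_piece.
apply: leq_trans Il; elim: I i => [[]//|I IH] i.
have [iI|iI] := ltnP i I; last first.
  by rewrite (_ : (i : nat) = I) //; have := ltn_ord i; lia.
apply: (leq_trans (IH (Ordinal iI))).
by rewrite /= leq_addl.
Qed.

Lemma cell_ge0 i t : 0 <= cell i t.
Proof. exact: (bump_ge0 cX). Qed.

Variables (F : int -> C) (B : R).
Hypotheses (F0 : F 0 = 0) (FB : wiener_le F B).

Let B0 : 0 <= B. Proof. exact: wiener_le_ge0 FB. Qed.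

Lemma piece_wiener i : wiener_le (piece F i) B.
Proof.
rewrite -[B]mulr1; apply: (@wiener_conv _ _ _ _ _ N) => //.
  exact: supp_translate (bump_supp cX).
exact: wiener_translate (bump_wiener cX).
Qed.

Lemma piece_coef i n : nc (piece F i n) <= B / L%:R.
Proof.
by apply: conv_coef_le => // k; rewrite ncM nc_ex mulr1 (bump_coef cX).
Qed.

(** The pieces have disjoint spectra, so the bound for one piece holds for the sum. *)
Lemma lacunary_coef I n : nc (lacunary F I n) <= B / L%:R.
Proof.
have BL : 0 <= B / L%:R by rewrite divr_ge0.
elim: I => [|I IH]; first by rewrite /lacunary big_ord0 nc0.
rewrite lacunaryS; have [nI|nI] := leqP `|n| (level I).
  by rewrite piece_low // addr0.
by rewrite (@lacunary_supp F I) // add0r piece_coef.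
Qed.

(* A partial sum cuts at most one piece: the earlier ones are complete, and the
   cut one is bounded by its Wiener norm. *)
Lemma lacunary_bound I l t :
  nc (psum (lacunary F I) l t) <= B * \sum_(i < I) cell i t + B.
Proof.
elim: I => [|I IH].
  rewrite psum_eq0 ?nc0 => [|n _]; last by rewrite /lacunary big_ord0.
  by rewrite big_ord0 mulr0 add0r.
rewrite (_ : psum _ _ _ = psum (lacunary F I) l t + psum (piece F I) l t); last first.
  by rewrite -psumD; apply: eq_ssum => n _; rewrite lacunaryS.
have [lI|lI] := leqP l (level I).
  rewrite [psum (piece _ _) _ _]psum_eq0 ?addr0; last first.
    by move=> n nl; rewrite piece_low // (leq_trans nl).
  apply: le_trans IH _; rewrite lerD2r big_ord_recr /= ler_wpM2l //.
  by rewrite lerDl cell_ge0.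
apply: le_trans (ncD _ _) _; apply: lerD; last exact/psum_wiener/piece_wiener.
rewrite psum_lacunary ?(ltnW lI) //; apply: le_trans (nc_sum _ _ _) _.
apply: (@le_trans _ _ (B * \sum_(i < I) cell i t)).
  rewrite mulr_sumr; apply: ler_sum => i _; rewrite ncM ncR ger0_norm ?cell_ge0 //.
  by rewrite ler_wpM2r ?cell_ge0 // psum_wiener.
by rewrite big_ord_recr /= ler_wpM2l // lerDl cell_ge0.
Qed.

Lemma lacunary_bound2 l t : nc (psum (lacunary F L) l t) <= 2 * B.
Proof.
apply: le_trans (lacunary_bound _ _ _) _.
by rewrite (bump_sum cX) mulr1 -mulr2n mulr_natl.
Qed.

(** The degree [N] of the bump is below every [freq i], so in each piece the sign is decided by the
    multiplier. *)
Lemma neg_lacunary I n : neg (lacunary F I) n = lacunary (neg F) I n.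
Proof.
transitivity (\sum_(i < I) neg (piece F i) n).
  by rewrite /neg /lacunary; case: ifP => // _; rewrite big1.
apply: eq_bigr => i _; apply: (@neg_conv_dilate _ _ _ _ _ N) => //.
  exact: supp_translate (bump_supp cX).
by rewrite /freq; lia.
Qed.

End LacunarySum.

(** * Smallness in outer measure, and preimages of arcs under dilation *)

Section OuterSmall.
Variable R : realType.
Local Notation C := R[i].
Local Notation tau := (pi *+ 2 : R).
Implicit Types (A B Z : set R) (a b : R).

(* Outer measure, so that no measurability has to be checked. *)
Definition small A a := (((@wlength R idfun)^*)%mu A <= a%:E)%E.

Lemma small_sub A B a : A `<=` B -> small B a -> small A a.
Proof. by move=> AB; apply: le_trans; apply: le_outer_measure. Qed.

Lemma small_le A a b : a <= b -> small A a -> small A b.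
Proof. by move=> ab /le_trans; apply; rewrite lee_fin. Qed.

Lemma small_set0 : small set0 0.
Proof. by rewrite /small outer_measure0. Qed.

Lemma smallU A B a b : small A a -> small B b -> small (A `|` B) (a + b).
Proof.
move=> sA sB; apply: le_trans (outer_measureU2 _ _ _) _.
by rewrite EFinD leeD.
Qed.

Lemma small_bigU n (F : nat -> set R) (f : nat -> R) :
  (forall i, (i < n)%N -> small (F i) (f i)) ->
  small [set t | exists2 i, (i < n)%N & F i t] (\sum_(i < n) f i).
Proof.
elim: n => [|n IH] sF.
  by rewrite big_ord0; apply: small_sub small_set0 => t [].
rewrite big_ord_recr /=; apply: small_sub (smallU (IH _) (sF n _)) => //.
  move=> t [k]; rewrite ltnS leq_eqVlt => /predU1P[->|nk] Fk; first by right.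
  by left; exists k.
by move=> i /ltnW; apply: sF.
Qed.

Lemma small_ball (c h : R) : 0 <= h -> small [set t | `|t - c| < h] (2 * h).
Proof.
move=> h0; rewrite /small mulr_natl -(lebesgue_measure_ball c h0).
apply: le_outer_measure => t /=.
by rewrite /ball /= distrC.
Qed.

(** The set is covered by intervals of length [2 h / n] spaced by [tau / n]; the first factor bounds
    the number of those that meet the ball. *)
Lemma small_lattice (c rho h : R) (n : nat) : 0 < h -> 0 <= rho -> (0 < n)%N ->
  small [set t | `|t - c| < rho /\ near2pi (n%:R * t) h]
    (((2 * n%:R * rho + 2 * h) / tau + 1) * (2 * (h / n%:R))).
Proof.
move=> h0 rho0 n0; have nR : (0 : R) < n%:R by rewrite ltr0n.
have t0 := tau_gt0 R.
set w := (_ / tau); have w0 : 0 <= w.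
  by rewrite divr_ge0 ?(ltW t0) // addr_ge0 ?mulr_ge0 // ltW.
(* The relevant integers satisfy [a < q < a + w], hence are among [q0 + 1 + j] with [j < J]. *)
set a := (n%:R * (c - rho) - h) / tau; set J := (Num.truncn w).+1.
pose q0 := Num.floor a.
have := @small_bigU J (fun j => [set t | `|t - (q0 + 1 + j%:Z)%:~R * tau / n%:R| < h / n%:R])
   (fun=> 2 * (h / n%:R)).
rewrite sumr_const card_ord -[_ *+ J]mulr_natl => H.
have : (J%:R * (2 * (h / n%:R)) <= (w + 1) * (2 * (h / n%:R))).
  rewrite ler_wpM2r ?mulr_ge0 ?divr_ge0 ?(ltW h0) //.
  by rewrite /J -addn1 natrD lerD2r truncn_le.
move=> /small_le; apply; apply: small_sub; last first.
  by apply: H => j _; apply: small_ball; rewrite divr_ge0 ?(ltW h0).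
move=> t /= [tc [q hq]].
have [q1 q2] : q%:~R * tau < n%:R * t + h /\ n%:R * t - h < q%:~R * tau.
  by move: hq; rewrite ltr_norml => /andP[]; lra.
have [t1 t2] : n%:R * t < n%:R * (c + rho) /\ n%:R * (c - rho) < n%:R * t.
  by rewrite !ltr_pM2l //; move: tc; rewrite ltr_norml => /andP[]; lra.
have aq : a < q%:~R by rewrite /a ltr_pdivrMr //; lra.
have q0q : q0 < q by rewrite -(ltr_int R); apply: le_lt_trans aq; exact: floor_le.
have wq : q%:~R - a < w.
  by rewrite /a /w ltrBlDr -mulrDl ltr_pdivlMr //; lra.
have q0a := floor_itv a; have a1 : a < q0%:~R + 1 by case/andP: q0a => _; rewrite intrD.
have jE : q = q0 + 1 + (absz (q - q0 - 1)%R)%:Z by clear -q0q; lia.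
exists (absz (q - q0 - 1)%R).
  rewrite ltnS truncn_ge_nat // pmulrn.
  have -> : ((absz (q - q0 - 1)%R)%:Z%:~R : R) = q%:~R - (q0%:~R + 1).
    by rewrite {2}jE !rmorphD /=; ring.
  by lra.
rewrite -jE ltr_pdivlMr // -[ltLHS](_ : `|n%:R * t - q%:~R * tau| = _) //.
rewrite -[X in _ = _ * X](gtr0_norm nR) -normrM; congr (`| _ |).
by field; rewrite gt_eqF.
Qed.

(** At most [4 n / L + 2] intervals of length [2 h / n] are counted; [L <= n] absorbs the additive
    term. Summed over [L] cells the result no longer depends on [L]. *)
Lemma small_lattice_cell (L : nat) (c h : R) (n : nat) : (2 <= L)%N -> 0 < h <= pi ->
  (L <= n)%N ->
  small [set t | `|t - c| < tau / L%:R *+ 2 /\ near2pi (n%:R * t) h] (12 * h / L%:R).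
Proof.
move=> L2 /andP[h0 hpi] Ln; have n0 : (0 < n)%N by apply: leq_trans Ln; apply: ltnW.
have LR : (0 : R) < L%:R by rewrite ltr0n ltnW.
have nR : (0 : R) < n%:R by rewrite ltr0n.
have t0 := tau_gt0 R.
apply: small_le (small_lattice c h0 _ n0); last first.
  by rewrite mulrn_wge0 // divr_ge0 ?(ltW t0).
have h1 : 2 * h / tau <= 1.
  by rewrite ler_pdivrMr // mul1r -[pi *+ 2]mulr_natl ler_wpM2l.
have -> : (2 * n%:R * (tau / L%:R *+ 2) + 2 * h) / tau = 4 * (n%:R / L%:R) + 2 * h / tau.
  set T := tau in t0 h1 *; clearbody T; rewrite -[T / L%:R *+ 2]mulr_natl; field.
  by rewrite !gt_eqF.
apply: (@le_trans _ _ ((4 * (n%:R / L%:R) + 2) * (2 * (h / n%:R)))).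
  rewrite ler_wpM2r ?mulr_ge0 ?divr_ge0 ?(ltW h0) //; lra.
rewrite (_ : _ * (2 * _) = 8 * h / L%:R + 4 * h / n%:R); last first.
  by field; rewrite !gt_eqF.
have : 4 * h / n%:R <= 4 * h / L%:R.
  by rewrite ler_wpM2l ?mulr_ge0 ?(ltW h0) // lef_pV2 // ler_nat.
by lra.
Qed.

End OuterSmall.

(** * One block: a polynomial times a lacunary factor *)

Section Block.
Variable R : realType.
Local Notation C := R[i].
Local Notation tau := (pi *+ 2 : R).

(** Since the cells sum to [1], the error is the sum of the cells times [F(n_i t) - 1]. Far from a
    cell its tail is used. Near it the multiplier is close to [1], unless [n_i t] falls in the arc,
    which defines [Z]. *)
Lemma lacunary_near1 (L : nat) (tail : R) (c : int -> C) N X (D N0 : nat)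
    (F : int -> C) (B eta h : R) (l : nat) :
  bump L tail c N X -> (2 <= L)%N -> wiener_le F B -> 0 < h <= pi ->
  0 <= eta -> 0 <= tail ->
  (forall s, ~ near2pi s h -> nc (psum F D s - 1) <= eta) ->
  (level L N D N0 L <= l)%N ->
  exists2 Z : set R, small Z (36 * h) & forall t : R, 0 <= t <= tau -> ~ Z t ->
    nc (psum (lacunary L c N D N0 F L) l t - 1) <= eta + L%:R * tail * (B + 1).
Proof.
move=> cX L2 FB hpi eta0 tail0 Fh Ll; have h0 : 0 < h by case/andP: hpi.
have LR : (0 : R) < L%:R by rewrite ltr0n ltnW.
have B0 := wiener_le_ge0 FB; have t0 := tau_gt0 R.
pose fr := freq L N D N0.
(* [j] encodes a cell [j %/ 3] and a period [j %% 3 - 1]: for [t] in [[0, tau]] only the periods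
   [-1], [0], [1] can bring a cell near [t]. Hence [36 h], three times [L] sets of size
   [12 h / L]. *)
pose Zi (j : nat) := [set t : R |
  `|t - ((j %/ 3)%:R * (tau / L%:R) + ((j %% 3)%:R - 1) * tau)| < tau / L%:R *+ 2
  /\ near2pi ((fr (j %/ 3)%N)%:R * t) h].
exists [set t | exists2 j, (j < 3 * L)%N & Zi j t].
  have -> : 36 * h = \sum_(j < 3 * L) (12 * h / L%:R).
    by rewrite sumr_const card_ord -[_ *+ (3 * L)]mulr_natl natrM; field; rewrite gt_eqF.
  apply: (@small_bigU _ (3 * L) Zi (fun=> 12 * h / L%:R)) => j _; apply: small_lattice_cell => //.
  (* The summand [L] in [freq] provides [L <= n]. *)
  by rewrite /fr /freq; lia.
move=> t /andP[tge tle] nZ; rewrite (psum_lacunary cX) //.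
have S1 : \sum_(i < L) (cell L X i t)%:C%C = 1 :> C.
  by rewrite -rmorph_sum (bump_sum cX) rmorph1.
rewrite -S1 -sumrB; apply: le_trans (nc_sum _ _ _) _.
apply: (@le_trans _ _ (\sum_(i < L) (cell L X i t * eta + tail * (B + 1)))); last first.
  rewrite big_split /= -mulr_suml (bump_sum cX) mul1r sumr_const card_ord.
  by rewrite -mulrnAr -mulr_natl mulrCA mulrA.
apply: ler_sum => i _; rewrite -{2}[(cell _ _ _ _)%:C%C]mul1r -mulrBl ncM ncR.
have ci := cell_ge0 cX i t; rewrite ger0_norm //.
have FB1 : nc (psum F D ((fr i)%:R * t) - 1) <= B + 1.
  by apply: le_trans (ncB _ _) _; rewrite nc1 lerD2r psum_wiener.
have B1 : 0 <= B + 1 by rewrite addr_ge0.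
have [nr|far] := pselect (near2pi (t - i%:R * (tau / L%:R)) (tau / L%:R *+ 2)); last first.
  have ct : cell L X i t <= tail by exact: (bump_far cX).
  apply: (@le_trans _ _ (tail * (B + 1))); last by rewrite lerDr mulr_ge0.
  by rewrite mulrC ler_pM // nc_ge0.
apply: (@le_trans _ _ (cell L X i t * eta)); last by rewrite lerDl mulr_ge0.
rewrite mulrC ler_wpM2l //; apply: Fh => nrh; apply: nZ.
case: nr => p hp.
have Lp : tau / L%:R * L%:R = tau by rewrite divfK // gt_eqF.
have iL : (i%:R : R) + 1 <= L%:R by rewrite -(natrD _ i 1) ler_nat addn1.
have Lge2 : (2 : R) <= L%:R by rewrite ler_nat.
set w := tau / L%:R in hp Lp *; have w0 : 0 < w by rewrite divr_gt0.
have p2 : (-2 < p < 2)%R.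
  move: hp; rewrite ltr_norml => /andP[h1 h2].
  have i0 : (0 : R) <= i%:R * w by rewrite mulr_ge0 // ltW.
  have iw : i%:R * w + w <= tau by rewrite -Lp; nra.
  have w2 : w * 2 <= tau by rewrite -Lp; nra.
  by apply/andP; split; rewrite -(ltr_int R) -(ltr_pM2r t0); lra.
have pE : exists2 j0 : nat, (j0 < 3)%N & p = j0%:Z - 1.
  by exists (absz (p + 1)%R); clear -p2; lia.
case: pE => j0 j3 pE.
have jE : ((i * 3 + j0) %/ 3 = i)%N /\ ((i * 3 + j0) %% 3 = j0)%N.
  by split; [rewrite divnMDl // divn_small // addn0 | rewrite modnMDl modn_small].
exists (i * 3 + j0)%N; first by have := ltn_ord i; clear -j3; lia.
rewrite /Zi /= jE.1 jE.2; split => //.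
move: hp; rewrite pE intrB -pmulrn; congr (`| _ | < _).
by rewrite opprD addrA.
Qed.

Lemma block_exists (q : int -> C) (d : nat) (F : int -> C) (D : nat) (B h eta theta : R)
    (N0 : nat) :
  F 0 = 0 -> wiener_le F B -> 0 < h <= pi -> 0 < eta -> 0 < theta ->
  (forall s, ~ near2pi s h -> nc (psum F D s - 1) <= eta) ->
  exists p N1, [/\ supp p N1, forall n, (`|n| <= N0)%N -> p n = 0,
    analytic F -> analytic p,
    forall l t, nc (psum p l t) <= 2 * B * nc (psum q d t) + theta /\
                nc (psum (neg p) l t) <= 2 * B * nc (psum q d t) + theta
    & exists2 Z : set R, small Z (36 * h) & forall t : R, 0 <= t <= tau -> ~ Z t ->
      nc (psum p N1 t - psum q d t) <= 2 * eta * nc (psum q d t)].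
Proof.
move=> F0 FB hpi eta0 theta0 Fh; have B0 := wiener_le_ge0 FB.
set K := ssum (fun k => nc (q k) * (2 * `|k|%:R)) d.
have K0 : 0 <= K by apply: ssum_ge0 => k; rewrite mulr_ge0 ?nc_ge0 // mulr_ge0.
(* [L] depends on [q] and [F]: it brings the error [K * (B / L)] of [psum_conv_approx] below
   [theta]. The size of the exceptional set is independent of it. *)
set L := (Num.truncn (B * K / theta)).+2.
have L2 : (2 <= L)%N by [].
have LR : (0 : R) < L%:R by rewrite ltr0n.
have KL : K * (B / L%:R) <= theta.
  rewrite mulrA ler_pdivrMr // [K * B]mulrC [theta * _]mulrC -ler_pdivrMr //.
  apply/ltW/(lt_le_trans (truncnS_gt _)); rewrite ler_nat.
  exact: leqnSn.
have B1 : 0 < B + 1 by lra.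
(* Chosen so that [L * tail * (B + 1) = eta], which doubles the accuracy [eta] in the conclusion. *)
set tail := eta / (L%:R * (B + 1)).
have tail0 : 0 < tail by rewrite divr_gt0 // mulr_gt0.
have [c [N [X cX]]] := bump_exists L2 tail0.
(* Starting beyond [N0 + d] leaves the product without frequencies up to [N0], and makes the
   negative part of the product equal to [Q] times that of [phi]. *)
set phi := lacunary L c N D (N0 + d) F L.
have phi_low n : (`|n| <= N0 + d)%N -> phi n = 0 by apply: (lacunary_low cX).
have phi_coef n : nc (phi n) <= B / L%:R by apply: (lacunary_coef cX).
have negE n : neg phi n = lacunary L c N D (N0 + d) (neg F) L n by apply: (neg_lacunary cX L2 _ _ F0 FB).
have phi_supp : supp phi (level L N D (N0 + d) L) by apply: (lacunary_supp cX).
have pnegE n : neg (conv 1 q d phi) n = conv 1 q d (neg phi) n.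
  by apply: neg_conv => k kd; apply: phi_low; rewrite (leq_trans kd) ?leq_addl.
exists (conv 1 q d phi), (d * 1 + level L N D (N0 + d) L)%N; split.
- exact: supp_conv.
- move=> n nN; apply: conv_eq0 => k kd _; apply: phi_low; clear -nN kd; lia.
- move=> /analytic_neg F_neg n n0; have := pnegE n; rewrite {1}/neg n0 => ->.
  rewrite conv_eq0 // => k _ _; rewrite negE /lacunary big1 // => i _.
  by apply: ssum_eq0 => j _; rewrite F_neg mul0r.
- move=> l t; split.
    apply: le_trans (_ : _ <= nc (psum q d t * psum phi l t) + theta) _.
      rewrite -lerBlDl.
      apply: le_trans (le_trans (psum_conv_approx q d l t phi_coef) KL).
      by rewrite lerBlDr -[X in nc X <= _](subrK (psum q d t * psum phi l t)) ncD.
    rewrite lerD2r ncM mulrC ler_wpM2r ?nc_ge0 //.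
    exact: (lacunary_bound2 cX).
  rewrite (_ : psum (neg _) l t = psum (conv 1 q d (neg phi)) l t); last first.
    by apply: eq_ssum => n _; rewrite pnegE.
  have nphi_coef n : nc (neg phi n) <= B / L%:R.
    by rewrite /neg; case: ifP => // _; rewrite nc0 divr_ge0.
  apply: le_trans (_ : _ <= nc (psum q d t * psum (neg phi) l t) + theta) _.
    rewrite -lerBlDl.
    apply: le_trans (le_trans (psum_conv_approx q d l t nphi_coef) KL).
    by rewrite lerBlDr -[X in nc X <= _](subrK (psum q d t * psum (neg phi) l t)) ncD.
  rewrite lerD2r ncM mulrC ler_wpM2r ?nc_ge0 //.
  rewrite (_ : psum _ l t = psum (lacunary L c N D (N0 + d) (neg F) L) l t); last first.
    by apply: eq_ssum => n _; rewrite negE.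
  apply: (lacunary_bound2 cX) => //.
  exact: wiener_neg.
have [Z sZ hZ] := @lacunary_near1 L tail c N X D (N0 + d) F B eta h _ cX L2 FB hpi
  (ltW eta0) (ltW tail0) Fh (leqnn _).
exists Z => // t t01 nZ; rewrite (@psum_conv _ _ _ _ _ (level L N D (N0 + d) L)) //.
rewrite mul1r -[X in _ - X]mulr1 -mulrBr ncM mulrC ler_wpM2r ?nc_ge0 //.
apply: le_trans (hZ t t01 nZ) _; rewrite [leRHS]mulr_natl mulr2n lerD2l.
by rewrite mulrAC [_ * tail]mulrC /tail divfK // gt_eqF // mulr_gt0.
Qed.

End Block.

(** * The Menshov multiplier and the analytic multiplier *)

Section Multipliers.
Variable R : realType.
Local Notation C := R[i].
Local Notation tau := (pi *+ 2 : R).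

Lemma psum_delta0 l t : psum (fun n => (0 == n)%:R : C) l t = 1.
Proof. by rewrite /psum (ssum_delta (fun n => ex n t)) ?ex0 // absz0. Qed.

Lemma wiener_delta0 : wiener_le (fun n => (0 == n)%:R : C) 1.
Proof.
move=> l; rewrite (@eq_ssum _ _ (fun n => (0 == n)%:R * 1)) ?ssum_delta // => n _.
by rewrite /= ncnat mulr1.
Qed.

(** The multiplier is [1 - L c], of mean zero since the bump has mean [1 / L]. The accuracy only
    affects the tail of the bump, so the norm [1 + L] does not depend on it. *)
Lemma menshov_multiplier (L : nat) (eta : R) : (2 <= L)%N -> 0 < eta ->
  exists F D, [/\ F 0 = 0, wiener_le F (1 + L%:R : R) &
    forall s, ~ near2pi s (tau / L%:R *+ 2) -> nc (psum F D s - 1) <= eta].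
Proof.
move=> L2 eta0; have LR : (0 : R) < L%:R by rewrite ltr0n ltnW.
have LC : (L%:R : C) != 0 by rewrite pnatr_eq0; case: L L2 {LR}.
have [c [N [X cX]]] := bump_exists L2 (divr_gt0 eta0 LR).
exists (fun n => (0 == n)%:R - L%:R * c n), N; split.
- by rewrite eqxx (bump_mean cX) fmorphV rmorph_nat mulfV // subrr.
- move=> l; apply: le_trans (_ : _ <= ssum (fun n => nc (0 == n)%:R + L%:R * nc (c n)) l) _.
    by apply: ler_ssum => n _ /=; apply: le_trans (ncB _ _) _; rewrite ncM !ncnat.
  rewrite ssumD ssumRMl lerD ?wiener_delta0 // -[leRHS]mulr1 ler_wpM2l //.
  exact: (bump_wiener cX).
move=> s far; rewrite psumB psum_delta0 psumMl (bump_val cX) addrAC subrr sub0r ncN.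
rewrite ncM ncnat ncR ger0_norm ?(bump_ge0 cX) // mulrC -ler_pdivlMr //.
exact: (bump_far cX).
Qed.

(** The mean [v] is recorded because it is multiplicative on analytic polynomials; this yields
    [F 0 = 0] for the power below. *)
Definition apoly (p : R -> C) (v : C) := exists a N,
  [/\ supp a N, analytic a, a 0 = v & forall t, psum a N t = p t].

Lemma apoly_cst (v : C) : apoly (fun=> v) v.
Proof.
exists (fun n => v * (0 == n)%:R), 0%N; split => [n n0|n n0||t].
- by rewrite (_ : (_ == _) = false) ?mulr0 //; apply/eqP; lia.
- by rewrite (_ : (_ == _) = false) ?mulr0 //; apply/eqP; lia.
- by rewrite eqxx mulr1.
by rewrite psumMl psum_delta0 mulr1.
Qed.

Lemma apolyB p q u v : apoly p u -> apoly q v -> apoly (fun t => p t - q t) (u - v).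
Proof.
move=> [a [N [aN aa a0 aE]]] [b [M [bM ba b0 bE]]].
exists (fun n => a n - b n), (N + M)%N; split => [n nNM|n n0||t].
- by rewrite aN ?bM ?subrr //; lia.
- by rewrite aa // ba // subrr.
- by rewrite a0 b0.
by rewrite psumB (psum_supp _ aN) ?leq_addr // (psum_supp _ bM) ?leq_addl // aE bE.
Qed.

Lemma apolyM p q u v : apoly p u -> apoly q v -> apoly (fun t => p t * q t) (u * v).
Proof.
move=> [a [N [aN aa a0 aE]]] [b [M [bM ba b0 bE]]].
exists (conv 1 a N b), (N * 1 + M)%N; split => [||| t].
- exact: supp_conv.
- exact: analytic_conv.
- by rewrite analytic_conv0 // a0 b0.
by rewrite (@psum_conv _ _ _ _ _ M) // mul1r aE bE.
Qed.

Lemma apolyX p u n : apoly p u -> apoly (fun t => p t ^+ n) (u ^+ n).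
Proof.
move=> pu; elim: n => [|n IH].
  by rewrite expr0; have := apoly_cst 1; congr apoly; apply/funext => t; rewrite expr0.
rewrite exprS (_ : (fun t => _) = fun t => p t * p t ^+ n); first exact: apolyM.
by apply/funext => t; rewrite exprS.
Qed.

Lemma Re_ssum_conj (G : int -> C) l : (forall n, G (- n) = (G n)^*%C) ->
  complex.Re (ssum G l) =
  complex.Re (G 0) + 2 * complex.Re (ssum (fun n => if 0 < n then G n else 0) l).
Proof.
move=> GN; have ReD (x y : C) : complex.Re (x + y) = complex.Re x + complex.Re y.
  by case: x y => [? ?] [].
elim: l => [|l IH]; first by rewrite !ssum0 ltxx mulr0 addr0.
rewrite !ssumS !ReD IH GN /=.
have -> : complex.Re ((G l.+1%:Z)^*%C) = complex.Re (G l.+1%:Z) by case: (G _).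
by ring.
Qed.

Lemma exp_small (x eta : R) : 0 <= x < 1 -> 0 < eta -> exists n, x ^+ n <= eta.
Proof.
move=> /andP[x0 x1] eta0.
have /cvgrPdist_le /(_ eta eta0) : (fun n => x ^+ n) @ \oo --> (0 : R).
  by apply: cvg_expr; rewrite ger0_norm.
move=> [n _ /(_ n (leqnn n))] /=; rewrite sub0r normrN ger0_norm ?exprn_ge0 // => h.
by exists n.
Qed.

(* Off a small arc the polynomial [1 - (1 + kappa A)^M] is close to [1]: [A] is
   analytic with [A(0) = 0] and [Re A <= -1/2] there, so [|1 + kappa A| < 1]. *)
Lemma analytic_multiplier (L : nat) (eta : R) : (2 <= L)%N -> 0 < eta ->
  exists F D B, [/\ analytic F, F 0 = 0, wiener_le F (B : R) &
    forall s, ~ near2pi s (tau / L%:R *+ 2) -> nc (psum F D s - 1) <= eta].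
Proof.
move=> L2 eta0; have LR : (0 : R) < L%:R by rewrite ltr0n ltnW.
(* With this tail [L X <= 1/2] off the arc, hence [Re A = L X - 1 <= -1/2]. *)
have tl0 : (0 : R) < (2 * L%:R)^-1 by rewrite invr_gt0 mulr_gt0.
have [c [N [X cX]]] := bump_exists L2 tl0.
(* Twice the positive frequencies of [L c]: a real polynomial of mean [1] minus its mean is the real
   part of this analytic one. *)
pose a n : C := if 0 < n then 2 * L%:R * c n else 0.
have aN : supp a N by move=> n /(bump_supp cX); rewrite /a => ->; rewrite mulr0; case: ifP.
have [K0 K0ge aK0] := wiener_exists aN.
pose K := K0 + 1; have K1 : 1 <= K by rewrite lerDr.
have aK t : nc (psum a N t) <= K.
  by apply: le_trans (psum_wiener _ _ aK0) _; rewrite lerDl.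
have ReA t : complex.Re (psum a N t) = L%:R * X t - 1.
  have := @Re_ssum_conj (fun n => c n * ex n t) N.
  rewrite -/(psum c N t) (bump_val cX) (bump_mean cX) ex0 mulr1 /= => H.
  have -> : psum a N t = 2 * L%:R * ssum (fun n => if 0 < n then c n * ex n t else 0) N.
    rewrite -ssumMl; apply: eq_ssum => n _; rewrite /a; case: ifP => _; first by rewrite mulrA.
    by rewrite mul0r mulr0.
  have ReM (x : R) (z : C) : complex.Re (x%:C%C * z) = x * complex.Re z.
    by case: z => u v; rewrite /= mul0r subr0.
  rewrite (_ : 2 * L%:R = (2 * L%:R : R)%:C%C); last by rewrite rmorphM !rmorph_nat.
  rewrite ReM H => [|n]; last by rewrite (bump_conj cX) exN rmorphM.
  by field; rewrite gt_eqF.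
(* Off the arc the square of the modulus of [1 + kap A] is at most
   [1 - kap + kap^2 K^2 = 1 - kap / 2], which is below [(1 - kap / 4)^2]. *)
pose kap := (2 * K ^+ 2)^-1.
have kap0 : 0 < kap by rewrite invr_gt0 mulr_gt0 // exprn_gt0 //; lra.
have kapK : kap ^+ 2 * K ^+ 2 = kap / 2.
  by rewrite /kap; field; rewrite gt_eqF //; lra.
have kap1 : kap <= 2^-1.
  rewrite /kap lef_pV2 ?posrE ?mulr_gt0 ?exprn_gt0 //; try lra.
  by rewrite ler_peMr // exprn_ege1.
pose H t : C := 1 + kap%:C%C * psum a N t.
have Hfar s : ~ near2pi s (tau / L%:R *+ 2) -> nc (H s) <= 1 - kap / 4.
  move=> far; have Xs : L%:R * X s <= 2^-1.
    rewrite mulrC -ler_pdivlMr // -invfM; exact: (bump_far cX).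
  rewrite -(@ler_pXn2r _ 2) ?nnegrE ?nc_ge0 //; last by lra.
  have : nc (psum a N s) ^+ 2 <= K ^+ 2.
    by rewrite ler_pXn2r ?nnegrE ?nc_ge0 // (le_trans ler01).
  rewrite !nc_sqr /H; move: (ReA s).
  case: (psum a N s) => u v /= -> {u}; move: Xs; set y := L%:R * X s => Xs nK2.
  have : kap ^+ 2 * ((y - 1) ^+ 2 + v ^+ 2) <= kap / 2.
    by rewrite -kapK ler_wpM2l // exprn_ge0 // ltW.
  rewrite !mul0r !subr0 !addr0 ?add0r.
  by nra.
have kapI : 0 <= 1 - kap / 4 < 1 by apply/andP; split; lra.
have [M hM] := exp_small kapI eta0.
have [F [D [FD Fa F0 FE]]] : apoly (fun t => 1 - H t ^+ M) 0.
  have aA : apoly (psum a N) 0.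
    by exists a, N; split => // n n0; rewrite /a ltNge (ltW n0).
  have := apolyB (apoly_cst 1) (apolyX M (apolyB (apoly_cst 1)
     (apolyM (apoly_cst (- kap%:C%C)) aA))).
  rewrite mulr0 subr0 expr1n subrr; congr apoly; apply/funext => t.
  by rewrite mulNr opprK.
have [B _ FB] := wiener_exists FD.
exists F, D, B; split => // s far; rewrite FE addrAC subrr sub0r ncN ncX.
apply: le_trans hM; apply: lerXn2r (Hfar s far); rewrite nnegrE ?nc_ge0 //.
by case/andP: kapI.
Qed.

End Multipliers.

(** * From Lebesgue to Borel functions, truncation, and Lusin's theorem *)

Section BorelApproximation.
Variable R : realType.
Local Notation C := R[i].
Local Notation tau := (pi *+ 2 : R).

Let A : set R := `[0, tau].

Let itv_finite_measure : (lebesgue_measure A < +oo)%E.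
Proof. by apply: compact_finite_measure; exact: segment_compact. Qed.

Lemma lusin_itv (u : R -> R) (delta : R) : measurable_fun [set: R] u -> 0 < delta ->
  exists K : set R, [/\ compact K, small [set t | 0 <= t <= tau /\ ~ K t] delta
    & {within K, continuous u}].
Proof.
move=> mu d0.
have mA : measurable A by exact: measurable_itv.
have [K [cK KA sK uK]] := measurable_almost_continuous mA itv_finite_measure d0
  (measurable_funTS mu).
exists K; split => //; apply: le_trans (ltW sK); apply: le_outer_measure => t [t01 nK].
by split => //=; rewrite in_itv.
Qed.

(** A function continuous on a compact set of almost full measure is bounded there. *)
Lemma small_trunc (u : R -> R) (delta : R) : measurable_fun [set: R] u -> 0 < delta ->
  exists2 M : R, 0 < M & small [set t | 0 <= t <= tau /\ M < `|u t|] delta.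
Proof.
move=> mu d0; have [K [cK sK uK]] := lusin_itv mu d0.
have /compact_bounded [M0 [_ hM]] := continuous_compact uK cK.
exists (`|M0| + 1); first by rewrite ltr_pwDr.
apply: small_sub sK => t [t01 tM]; split => // Kt.
have := hM (`|M0| + 1); rewrite (le_lt_trans (ler_norm M0)) ?ltrDl //.
by move=> /(_ isT (u t)) /=; rewrite leNgt tM => H; apply: notF; apply: H; exists t.
Qed.

Lemma lusin_continuous (u : R -> R) (M delta : R) : measurable_fun [set: R] u ->
  0 < M -> (forall t, `|u t| <= M) -> 0 < delta ->
  exists g : R -> R, [/\ continuous g, forall t, `|g t| <= M
    & small [set t | 0 <= t <= tau /\ g t <> u t] delta].
Proof.
move=> mu M0 uM d0; have [K [cK sK uK]] := lusin_itv mu d0.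
have clK : closed K by apply: compact_closed => //; exact: Rhausdorff.
have [g [gu cg gM]] := continuous_bounded_extension
  (@pseudometric_normal R R) clK (f := u) M0 uK (fun t _ => uM t).
exists g; split => //; apply: small_sub sK => t [t01 ne]; split => // Kt; apply: ne.
by rewrite gu // inE.
Qed.

(** For rational [q] the set where [u > q] is Borel up to a Borel null set. Off the countable union
    of these null sets [u] is Borel, because [u > a] is the union of the [u > q] over rational
    [q > a]; on the union it is replaced by [0]. *)
Lemma lebesgue_borel (u : R -> R) : measurable_fun [set: lebesgueType R] u ->
  exists2 u0 : R -> R, measurable_fun [set: R] u0 & small [set t | u0 t <> u t] 0.
Proof.
move=> mu.
have sp (q : rat) : exists AN : set R * set R,
   [/\ measurable AN.1, measurable AN.2, lebesgue_measure AN.2 = 0%E &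
     forall t, ~ AN.2 t -> (AN.1 t <-> ratr q < u t)].
  have := mu measurableT _ (measurable_itv `]ratr q, +oo[).
  rewrite setTI -[X in X _ -> _]/((((@wlength R idfun)^*)%mu).-cara.-measurable).
  rewrite -completed_caratheodory_measurable g_sigma_completed_algebra_genE.
  move=> [B mB [N [N' [mN' N'0 NN']]] BN]; exists (B, N'); split => //= t nN'.
  have := congr1 (fun S : set R => S t) BN; rewrite /= in_itv /= andbT => <-.
  by split=> [Bt|[//|/NN']]; [left|].
have [S hS] := choice sp.
pose N := \bigcup_q (S q).2.
have mN : measurable N by apply: bigcupT_measurable_rat => q; case: (hS q).
pose N' (n : nat) := if unpickle n is Some q then (S q).2 else set0.
have NN' : N = \bigcup_n N' n.
  apply/seteqP; split => [t [q _ Nq]|t [n _]].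
    have pq : unpickle (pickle q) = Some q by exact: pickleK.
    by exists (pickle q); [exact: I | rewrite /N' pq].
  by rewrite /N'; case: (unpickle n) => // q Nq; exists q.
have N0 : (@lebesgue_measure R).-negligible N.
  rewrite NN'; apply: negligible_bigcup => n; rewrite /N'.
  case: (unpickle n) => [q|]; last exact: negligible_set0.
  by apply/negligibleP; case: (hS q).
have uN : measurable_fun (~` N) u.
  move=> mNC; apply: (measurability _ (RGenOInfty.measurableE R)) => //.
  move=> /= _ [_ [a ->] <-]; rewrite preimage_itvoy.
  rewrite [X in measurable X](_ : _ =
     \bigcup_(q : rat) (if a < ratr q then (S q).1 `&` ~` N else set0)).
    apply: bigcupT_measurable_rat => q; case: ifP => // _; apply: measurableI => //.
    by case: (hS q).
  apply/seteqP; split => [t [/= nN]|t [q _]].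
    move=> /rat_in_itvoo[q]; rewrite inE /= => /itvP hq; exists q => //.
    rewrite hq; split => //; case: (hS q) => _ _ _ h; apply/h; last by rewrite hq.
    by move=> ?; apply: nN; exists q.
  case: ifP => // aq [St nN]; split => //=; apply: lt_trans aq _.
  by case: (hS q) => _ _ _ h; apply/h => // ?; apply: nN; exists q.
exists (u \_ (~` N)); first by apply/(measurable_restrictT _ (measurableC mN)).
have Ns : small N 0 by rewrite /small ((negligible_outer_measure N).1 N0).
apply: small_sub Ns => t /= ne; apply: contrapT => nN; apply: ne.
by rewrite patchE; case: ifPn => //; rewrite notin_setE => h; case: h.
Qed.

End BorelApproximation.

(** * Measurability and continuity of complex functions by components *)

Section ComplexBorel.
Variable R : realType.
Local Notation C := R[i].
Local Notation tau := (pi *+ 2 : R).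

Definition borelC (w : R -> C) :=
  measurable_fun [set: R] (fun t => complex.Re (w t)) /\
  measurable_fun [set: R] (fun t => complex.Im (w t)).

Definition contC (w : R -> C) :=
  continuous (fun t => complex.Re (w t)) /\ continuous (fun t => complex.Im (w t)).

Lemma ReD (x y : C) : complex.Re (x + y) = complex.Re x + complex.Re y.
Proof. by case: x y => [? ?] []. Qed.

Lemma ImD (x y : C) : complex.Im (x + y) = complex.Im x + complex.Im y.
Proof. by case: x y => [? ?] []. Qed.

Lemma ReB (x y : C) : complex.Re (x - y) = complex.Re x - complex.Re y.
Proof. by case: x y => [? ?] []. Qed.

Lemma ImB (x y : C) : complex.Im (x - y) = complex.Im x - complex.Im y.
Proof. by case: x y => [? ?] []. Qed.

Lemma contC_add (v w : R -> C) : contC v -> contC w -> contC (fun t => v t + w t).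
Proof.
move=> [v1 v2] [w1 w2]; split.
  under [X in continuous X]eq_fun do rewrite ReD.
  by move=> t; apply: (@continuousD R R^o R); [exact: v1|exact: w1].
under [X in continuous X]eq_fun do rewrite ImD.
by move=> t; apply: (@continuousD R R^o R); [exact: v2|exact: w2].
Qed.

Lemma contC_mul (v w : R -> C) : contC v -> contC w -> contC (fun t => v t * w t).
Proof.
move=> [v1 v2] [w1 w2]; split.
  rewrite (_ : (fun t => _) = fun t => complex.Re (v t) * complex.Re (w t)
    - complex.Im (v t) * complex.Im (w t)); last first.
    by apply/funext => t; case: (v t) (w t) => [? ?] [].
  by move=> t; apply: (@cvgB _ R^o); apply: cvgM; [exact: v1|exact: w1|exact: v2|exact: w2].
rewrite (_ : (fun t => _) = fun t => complex.Re (v t) * complex.Im (w t)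
    + complex.Im (v t) * complex.Re (w t)); last first.
  by apply/funext => t; case: (v t) (w t) => [? ?] [].
by move=> t; apply: (@cvgD _ R^o); apply: cvgM; [exact: v1|exact: w2|exact: v2|exact: w1].
Qed.

Lemma contC_cst (a : C) : contC (fun=> a).
Proof. by split=> t; exact: cvg_cst. Qed.

Lemma contC_ex n : contC (ex n).
Proof.
have hn : continuous (fun t : R => n%:~R * t).
  by move=> t; apply: cvgM; [exact: cvg_cst | exact: cvg_id].
split.
  change (continuous (@cos R \o (fun t : R => n%:~R * t))) => t.
  by apply: continuous_comp; [exact: hn | exact: continuous_cos].
change (continuous (@sin R \o (fun t : R => n%:~R * t))) => t.
by apply: continuous_comp; [exact: hn | exact: continuous_sin].
Qed.

Lemma contC_psum (c : int -> C) l : contC (psum c l).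
Proof.
elim: l => [|l IH].
  rewrite (_ : psum c 0 = fun t => c 0 * ex 0 t).
    by apply: contC_mul; [exact: contC_cst | exact: contC_ex].
  by apply/funext => t; rewrite /psum ssum0.
rewrite (_ : psum c l.+1 = fun t => c (- l.+1%:Z) * ex (- l.+1%:Z) t + psum c l t
   + c l.+1%:Z * ex l.+1%:Z t); last by apply/funext => t; rewrite /psum ssumS.
by do 2?apply: contC_add => //; apply: contC_mul; [exact: contC_cst|exact: contC_ex|
  exact: contC_cst|exact: contC_ex].
Qed.

Lemma contC_borel w : contC w -> borelC w.
Proof. by move=> [w1 w2]; split; exact: continuous_measurable_fun. Qed.

Lemma borelC_sub (v w : R -> C) : borelC v -> borelC w -> borelC (fun t => v t - w t).
Proof.
move=> [v1 v2] [w1 w2]; split.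
  by under eq_fun do rewrite ReB; exact: measurable_funB.
by under eq_fun do rewrite ImB; exact: measurable_funB.
Qed.

Lemma borelC_if (b : R -> bool) (v w : R -> C) : measurable_fun [set: R] b ->
  borelC v -> borelC w -> borelC (fun t => if b t then v t else w t).
Proof.
move=> mb [v1 v2] [w1 w2]; split.
  rewrite (_ : (fun t => _) = fun t => if b t then complex.Re (v t) else complex.Re (w t)).
    exact: measurable_fun_ifT.
  by apply/funext => t; case: ifP.
rewrite (_ : (fun t => _) = fun t => if b t then complex.Im (v t) else complex.Im (w t)).
  exact: measurable_fun_ifT.
by apply/funext => t; case: ifP.
Qed.

Lemma nc_le_measurable (w : R -> C) (e : R) : 0 <= e -> borelC w ->
  measurable_fun [set: R] (fun t => nc (w t) <= e).
Proof.
move=> e0 [w1 w2]; rewrite (_ : (fun t => _) = fun t =>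
  complex.Re (w t) ^+ 2 + complex.Im (w t) ^+ 2 <= e ^+ 2).
  apply: measurable_fun_ler; last exact: measurable_cst.
  by apply: measurable_funD; apply: measurable_funX.
by apply/funext => t; rewrite -nc_sqr ler_pXn2r // nnegrE nc_ge0.
Qed.

Lemma heine_itv (g : R -> R) (theta : R) : continuous g -> 0 < theta ->
  exists2 rho : R, 0 < rho & forall t s : R, 0 <= t <= tau -> `|t - s| < rho ->
    `|g t - g s| <= theta.
Proof.
move=> cg th0; pose P (n : nat) (t : R) := forall s, `|t - s| < n.+1%:R^-1 ->
  `|g t - g s| <= theta.
have Hc := (compact_near_coveringP _).1 (@segment_compact R 0 tau) nat \oo P _.
have [|n _ Hn] := Hc _.
- move=> t _; have th2 : 0 < theta / 2 by rewrite divr_gt0.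
  have /cvgrPdist_lt /(_ _ th2) := cg t.
  move=> [d /= d0 hd]; have d2 : 0 < d / 2 by rewrite divr_gt0.
  near=> x n => s /= xs.
  have xt : `|t - x| < d / 2 by near: x; exact: (@nbhsx_ballx R R^o t (d / 2)).
  have n2 : n.+1%:R^-1 < d / 2 by near: n; exact: near_infty_natSinv_lt (PosNum d2).
  have h1 : `|g t - g x| < theta / 2 by apply: hd => /=; apply: lt_trans xt _; rewrite ltr_pdivrMr // ltr_pMr // ltr1n.
  have xs2 := lt_trans xs n2.
  have h2 : `|g t - g s| < theta / 2.
    apply: hd => /=; rewrite -[t - s](subrKA x) (le_lt_trans (ler_normD _ _)) //.
    by rewrite [ltRHS]splitr ltrD.
  rewrite -[g x - g s](subrKA (g t)) (le_trans (ler_normD _ _)) // distrC.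
  by rewrite [leRHS]splitr lerD // ltW.
- exists n.+1%:R^-1; first by rewrite invr_gt0.
  by move=> t s t01; apply: (Hn n (leqnn n)); rewrite /= in_itv.
Unshelve. all: by end_near.
Qed.

End ComplexBorel.

(** * Approximation in measure by trigonometric polynomials *)

Section TrigonometricApproximation.
Variable R : realType.
Local Notation C := R[i].
Local Notation tau := (pi *+ 2 : R).

(** The approximant is a convex combination of sampled values of [g], so it inherits the bound [G].
    As [g] is not assumed periodic, neighbourhoods of [0] and [tau], where a cell of the other end
    is visible, are discarded. *)
Lemma contC_approx (g : R -> C) (G theta delta : R) : contC g -> (forall t, nc (g t) <= G) ->
  0 < theta -> 0 < delta ->
  exists q d, [/\ supp q d, forall t, nc (psum q d t) <= G
    & exists2 Z : set R, small Z delta & forall t : R, 0 <= t <= tau -> ~ Z t ->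
      nc (psum q d t - g t) <= theta].
Proof.
move=> [g1 g2] gG th0 d0; have t0 := tau_gt0 R.
have G0 : 0 <= G by apply: le_trans (gG 0); exact: nc_ge0.
have th4 : 0 < theta / 4 by rewrite divr_gt0.
have [r1 r10 h1] := heine_itv g1 th4; have [r2 r20 h2] := heine_itv g2 th4.
pose rho := Num.min r1 r2.
have rho0 : 0 < rho by rewrite lt_min r10.
have hg t s : 0 <= t <= tau -> `|t - s| < rho -> nc (g t - g s) <= theta / 2.
  rewrite lt_min => t01 /andP[ts1 ts2]; apply: le_trans (nc_le_ReIm _) _.
  rewrite ReB ImB; have := h1 _ _ t01 ts1; have := h2 _ _ t01 ts2; lra.
(* The two summands give [2 tau / L < rho] for uniform continuity and [8 tau / L <= delta] for the
   two discarded balls. *)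
set x := tau * (2 / rho + 8 / delta).
set L := (Num.truncn x).+2.
have L2 : (2 <= L)%N by [].
have LR : (0 : R) < L%:R by rewrite ltr0n.
have xL : x < L%:R by apply: lt_le_trans (truncnS_gt _) _; rewrite ler_nat.
have rd0 : 0 < tau * (2 / rho) /\ 0 < tau * (8 / delta).
  by split; rewrite mulr_gt0 // divr_gt0.
have Lrho : tau / L%:R *+ 2 < rho.
  have : tau * (2 / rho) < L%:R by apply: lt_trans xL; rewrite /x mulrDr ltrDl; case: rd0.
  by rewrite mulrA ltr_pdivrMr // => h; rewrite -mulr_natr mulrAC ltr_pdivrMr // [rho * _]mulrC.
have Ldel : tau / L%:R * 8 <= delta.
  have : tau * (8 / delta) < L%:R by apply: lt_trans xL; rewrite /x mulrDr ltrDr; case: rd0.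
  by rewrite mulrA ltr_pdivrMr // => /ltW h; rewrite mulrAC ler_pdivrMr // [delta * _]mulrC.
have G1 : 0 < G + 1 by lra.
(* The far cells contribute at most [L * tail * 2 (G + 1) = theta / 2]. *)
pose tail := theta / (4 * L%:R * (G + 1)).
have tail0 : 0 < tail by rewrite divr_gt0 // !mulr_gt0.
have [c [N [X cX]]] := bump_exists L2 tail0.
pose pt (i : nat) : R := i%:R * (tau / L%:R).
pose q n := \sum_(i < L) g (pt i) * translate c (pt i) n.
have qE t : psum q N t = \sum_(i < L) g (pt i) * (cell L X i t)%:C%C.
  rewrite psum_sum; apply: eq_bigr => i _.
  by rewrite psumMl psum_translate (bump_val cX).
have cell0 i t : 0 <= cell L X i t by apply: (cell_ge0 cX).
have cell1 t : \sum_(i < L) cell L X i t = 1 by apply: (bump_sum cX).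
exists q, N; split.
- move=> n nN; rewrite /q big1 // => i _.
  by rewrite (supp_translate _ (bump_supp cX)) // mulr0.
- move=> t; rewrite qE; apply: le_trans (nc_sum _ _ _) _.
  rewrite -[G]mul1r -(cell1 t) mulr_suml; apply: ler_sum => i _.
  by rewrite ncM ncR ger0_norm // mulrC ler_wpM2l.
exists ([set t | `|t - 0| < tau / L%:R *+ 2] `|` [set t | `|t - tau| < tau / L%:R *+ 2]).
  apply: (small_le Ldel).
  have w0 : 0 <= tau / L%:R *+ 2 by rewrite mulrn_wge0 // divr_ge0 // ltW.
  have := smallU (small_ball 0 w0) (small_ball tau w0).
  by apply: small_le; rewrite -mulr_natl; lra.
move=> t t01 nZ; rewrite qE.
have -> : g t = \sum_(i < L) g t * (cell L X i t)%:C%C.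
  by rewrite -mulr_sumr -rmorph_sum cell1 rmorph1 mulr1.
rewrite -sumrB; apply: le_trans (nc_sum _ _ _) _.
apply: (@le_trans _ _ (\sum_(i < L) (cell L X i t * (theta / 2) + tail * (2 * (G + 1))))); last first.
  rewrite big_split /= -mulr_suml cell1 mul1r sumr_const card_ord -[_ *+ L]mulr_natl.
  rewrite /tail [_ * (_ * (2 * _))](_ : _ = theta / 2); first by lra.
  by field; rewrite !gt_eqF.
apply: ler_sum => i _; rewrite -mulrBl ncM ncR ger0_norm //.
have [nr|far] := pselect (near2pi (t - pt i) (tau / L%:R *+ 2)); last first.
  have ct : cell L X i t <= tail by exact: (bump_far cX).
  apply: (@le_trans _ _ (tail * (2 * (G + 1)))); last first.
    by rewrite lerDr mulr_ge0 // divr_ge0 // ltW.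
  rewrite mulrC ler_pM ?nc_ge0 //; apply: le_trans (ncB _ _) _.
  by have := gG (pt i); have := gG t; lra.
apply: (@le_trans _ _ (cell L X i t * (theta / 2))); last first.
  by rewrite lerDl mulr_ge0 ?(ltW tail0) // mulr_ge0 // (ltW G1).
rewrite mulrC ler_wpM2l // nc_distC hg //.
case: nr => p hp.
have Lp : tau / L%:R * L%:R = tau by rewrite divfK // gt_eqF.
have iL : (i%:R : R) + 1 <= L%:R by rewrite -(natrD _ i 1) ler_nat addn1.
have Lge2 : (2 : R) <= L%:R by rewrite ler_nat.
have i0 : 0 <= pt i by rewrite mulr_ge0 // divr_ge0 // ltW.
have iw : pt i + tau / L%:R <= tau.
  by rewrite -[X in _ <= X]Lp /pt -{2}[tau / L%:R]mul1r -mulrDl [leRHS]mulrC ler_wpM2r // divr_ge0 // ltW.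
have w0 : 0 < tau / L%:R by rewrite divr_gt0.
have w2 : tau / L%:R *+ 2 <= tau.
  by rewrite -[X in _ <= X]Lp -[_ *+ 2]mulr_natr ler_wpM2l // ltW.
move/andP: t01 => [t1 t2]; move: Lrho hp nZ w2 iw i0; rewrite /= /pt.
set w := tau / L%:R in w0 *; set y := i%:R * w => Lrho hp nZ w2 iw i0.
(* A nonzero period would put [t] within two cell widths of [0] or of [tau], both excluded by
   [Z]. *)
have p0 : p = 0.
  have [h|h] : p < 1 \/ 1 <= p by case: (ltP p 1); [left|right].
    have [h'|h'] : p < 0 \/ 0 <= p by case: (ltP p 0); [left|right].
      exfalso; apply: nZ; left; rewrite /= subr0 ger0_norm //.
      have : p%:~R <= -1 :> R by rewrite -[-1]/((-1)%:~R) ler_int; clear -h'; lia.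
      rewrite -(ler_pM2r t0) mulN1r => pt1.
      move: hp; rewrite ltr_norml => /andP[]; lra.
    by clear -h h'; lia.
  exfalso; apply: nZ; right; rewrite /= ltr_norml.
  have : 1 <= p%:~R :> R by rewrite -[1]/(1%:~R) ler_int.
  rewrite -(ler_pM2r t0) mul1r => pt1.
  move: hp; rewrite ltr_norml => /andP[]; lra.
by move: hp; rewrite p0 mul0r subr0 => /lt_trans; apply.
Qed.

(* Lusin's theorem and Tietze's extension reduce the statement to continuous functions. *)
Lemma borelC_approx (w : R -> C) (M theta delta : R) : borelC w -> 0 < M ->
  (forall t, nc (w t) <= M) -> 0 < theta -> 0 < delta ->
  exists q d, [/\ supp q d, forall t, nc (psum q d t) <= 2 * M
    & exists2 Z : set R, small Z delta & forall t : R, 0 <= t <= tau -> ~ Z t ->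
      nc (psum q d t - w t) <= theta].
Proof.
move=> [w1 w2] M0 wM th0 d0; have d3 : 0 < delta / 3 by rewrite divr_gt0.
have [g1 [cg1 g1M s1]] := lusin_continuous w1 M0
  (fun t => le_trans (nc_Re _) (wM t)) d3.
have [g2 [cg2 g2M s2]] := lusin_continuous w2 M0
  (fun t => le_trans (nc_Im _) (wM t)) d3.
pose g t : C := Complex (g1 t) (g2 t).
have cg : contC g by split.
(* The two components are extended separately, whence the factor [2]. *)
have gM t : nc (g t) <= 2 * M.
  apply: le_trans (nc_le_ReIm _) _; rewrite /=; have := g1M t; have := g2M t; lra.
have [q [d [qd qM [Z sZ hZ]]]] := contC_approx cg gM th0 d3.
exists q, d; split => //.
exists (Z `|` ([set t | 0 <= t <= tau /\ g1 t <> complex.Re (w t)] `|`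
               [set t | 0 <= t <= tau /\ g2 t <> complex.Im (w t)])).
  have := smallU sZ (smallU s1 s2); apply: small_le; lra.
move=> t t01 nZ; have -> : w t = g t.
  have e1 : g1 t = complex.Re (w t) by apply: contrapT => h; apply: nZ; right; left.
  have e2 : g2 t = complex.Im (w t) by apply: contrapT => h; apply: nZ; right; right.
  by rewrite /g e1 e2; case: (w t).
by apply: hZ => // Zt; apply: nZ; left.
Qed.

End TrigonometricApproximation.

(** * One correction of the remainder *)

Section CorrectionStep.
Variable R : realType.
Local Notation C := R[i].
Local Notation tau := (pi *+ 2 : R).

(** The closeness of [Q] itself to [w] is kept in the conclusion: where [w] vanishes it makes [Q],
    and with it all partial sums of the block, small. *)
Lemma psum_block (q F : int -> C) (d D : nat) (B h eta theta : R) (N0 : nat) (w : R -> C)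
    (M delta nu : R) :
  F 0 = 0 -> wiener_le F B -> 0 < h <= pi -> 0 < eta -> 0 < theta ->
  (forall s, ~ near2pi s h -> nc (psum F D s - 1) <= eta) ->
  (forall t, nc (psum q d t) <= M) ->
  (exists2 Z : set R, small Z delta & forall t : R, 0 <= t <= tau -> ~ Z t ->
      nc (psum q d t - w t) <= nu) ->
  exists p N1, [/\ supp p N1, forall n, (`|n| <= N0)%N -> p n = 0,
    analytic F -> analytic p,
    forall l t, nc (psum p l t) <= 2 * B * nc (psum q d t) + theta /\
                nc (psum (neg p) l t) <= 2 * B * nc (psum q d t) + theta
    & exists2 Z : set R, small Z (36 * h + delta) & forall t : R, 0 <= t <= tau -> ~ Z t ->
      nc (psum p N1 t - w t) <= 2 * eta * M + nu /\ nc (psum q d t - w t) <= nu].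
Proof.
move=> F0 FB hpi eta0 th0 Fh qM [Z sZ hZ].
have [p [N1 [pN1 pN0 pa pb [Z' sZ' hZ']]]] := block_exists q d N0 F0 FB hpi eta0 th0 Fh.
exists p, N1; split => //; exists (Z' `|` Z); first exact: smallU.
move=> t t01 nZ; have nZ1 : ~ Z' t by move=> ?; apply: nZ; left.
have nZ2 : ~ Z t by move=> ?; apply: nZ; right.
split; last exact: hZ.
apply: le_trans (nc_dist_trans (psum q d t) _ _) _; apply: lerD; last exact: hZ.
apply: le_trans (hZ' t t01 nZ1) _; apply: ler_wpM2l => //.
by rewrite mulr_ge0 // ltW.
Qed.

(* The small part of [r] is corrected by the Menshov multiplier, whose Wiener
   norm [1 + L] does not depend on the accuracy; the large part, supported on a
   set that is small by induction, by the analytic multiplier, which has no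
   negative frequencies but no norm control. *)
Lemma correction_step (r : R -> C) (L N0 : nat) (e e' : R) : borelC r -> (4 <= L)%N ->
  0 < e -> 0 < e' ->
  exists p N1, [/\ supp p N1, forall n, (`|n| <= N0)%N -> p n = 0,
    forall l t, nc (psum (neg p) l t) <= 5 * (1 + L%:R) * e
    & exists2 Z : set R, small Z (76 * (tau / L%:R *+ 2)) & forall t : R, 0 <= t <= tau -> ~ Z t ->
      nc (r t - psum p N1 t) <= e' /\
      (nc (r t) <= e -> forall l, nc (psum p l t) <= 6 * (1 + L%:R) * e)].
Proof.
move=> br L4 e0 e'0; have t0 := tau_gt0 R.
have L2 : (2 <= L)%N by apply: leq_trans L4.
have LR : (0 : R) < L%:R by rewrite ltr0n (leq_trans _ L4).
set h := tau / L%:R *+ 2.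
have h0 : 0 < h by rewrite mulrn_wgt0 // divr_gt0.
have hpi : 0 < h <= pi.
  rewrite h0 /h -mulr_natl mulrA ler_pdivrMr // -[pi *+ 2]mulr_natl mulrA -natrM.
  by rewrite mulrC ler_wpM2l ?pi_ge0 // ler_nat.
have [r1 r2] := br.
have [M1 M10 sM1] := small_trunc r1 h0; have [M2 M20 sM2] := small_trunc r2 h0.
pose M := M1 + M2; have M0 : 0 < M by rewrite addr_gt0.
pose g t := if nc (r t) <= e then r t else 0.
pose b t := if nc (r t) <= e then 0 else if nc (r t) <= M then r t else 0.
have mle x : 0 <= x -> measurable_fun [set: R] (fun t => nc (r t) <= x).
  by move=> x0; apply: nc_le_measurable.
have b0C : borelC (fun=> 0 : C) by apply/contC_borel/contC_cst.
have bg : borelC g by apply: borelC_if => //; apply: mle; exact: ltW.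
have bb : borelC b.
  by do 2?[apply: borelC_if => //]; apply: mle; exact: ltW.
have gE t : nc (g t) <= e by rewrite /g; case: ifP => // _; rewrite nc0 ltW.
have bE t : nc (b t) <= M.
  rewrite /b; case: ifP => _; first by rewrite nc0 ltW.
  by case: ifP => // _; rewrite nc0 ltW.
pose B := 1 + L%:R : R; have B1 : 1 <= B by rewrite lerDl ltW.
(* Gives [2 * eta * (2 e) = e' / 4]; together with the approximation error [e' / 4] the Menshov
   block uses half of [e']. *)
have etag0 : 0 < e' / (16 * e) by rewrite divr_gt0 // mulr_gt0.
have [F [D [F0 FB Fh]]] := menshov_multiplier L2 etag0.
have e4 : 0 < e' / 4 by rewrite divr_gt0.
have [q [d [qd qM qZ]]] := borelC_approx bg e0 gE e4 h0.
have [p [N1 [pN1 pN0 _ pb [Z1 sZ1 hZ1]]]] :=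
  psum_block N0 F0 FB hpi etag0 e0 Fh qM qZ.
have etab0 : 0 < e' / (16 * M) by rewrite divr_gt0 // mulr_gt0.
have [F' [D' [B' [F'a F'0 F'B F'h]]]] := analytic_multiplier L2 etab0.
have B'0 := wiener_le_ge0 F'B; have B'1 : 0 < B' + 1 by lra.
(* Chosen after [B']: where [b] vanishes the approximant is at most [nu], and the second term then
   keeps the analytic partial sums below [2 B' nu + e / 2 <= e]. *)
pose nu := Num.min (e' / 4) (e / (4 * (B' + 1))).
have nu0 : 0 < nu by rewrite lt_min e4 divr_gt0 // mulr_gt0.
have nu1 : nu <= e' / 4 by rewrite ge_min lexx.
have nu2 : 2 * B' * nu <= e / 2.
  apply: (@le_trans _ _ (2 * (B' + 1) * (e / (4 * (B' + 1))))).
    by apply: ler_pM; rewrite ?mulr_ge0 ?(ltW nu0) //; [lra | rewrite ge_min lexx orbT].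
  by rewrite le_eqVlt; apply/orP; left; apply/eqP; field; rewrite gt_eqF.
have [q' [d' [q'd q'M q'Z]]] := borelC_approx bb M0 bE nu0 h0.
have e2 : 0 < e / 2 by rewrite divr_gt0.
have [p' [N1' [p'N1 p'N0 p'a p'b [Z2 sZ2 hZ2]]]] :=
  psum_block N0 F'0 F'B hpi etab0 e2 F'h q'M q'Z.
have boundg t : 2 * B * nc (psum q d t) + e <= 5 * B * e.
  have := qM t; nra.
exists (fun n => p n + p' n), (N1 + N1')%N; split.
- by move=> n nN; rewrite pN1 ?p'N1 ?addr0 //; clear -nN; lia.
- by move=> n nN; rewrite pN0 // p'N0 // addr0.
- move=> l t; rewrite (_ : psum _ l t = psum (neg p) l t); last first.
    apply: eq_ssum => n _; rewrite /neg; case: ifP => // n0.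
    by rewrite (p'a F'a n n0) addr0.
  exact: le_trans (pb l t).2 (boundg t).
pose T := [set t | 0 <= t <= tau /\ M1 < `|complex.Re (r t)|] `|`
          [set t | 0 <= t <= tau /\ M2 < `|complex.Im (r t)|].
exists (Z1 `|` (Z2 `|` T)).
  (* Each block costs [36 h + h] and each truncation [h], in total [76 h]. *)
  have := smallU sZ1 (smallU sZ2 (smallU sM1 sM2)); apply: small_le; lra.
move=> t t01 nZ.
have n1 : ~ Z1 t by move=> ?; apply: nZ; left.
have n2 : ~ Z2 t by move=> ?; apply: nZ; right; left.
have rM : nc (r t) <= M.
  apply: le_trans (nc_le_ReIm _) _; apply: lerD.
    by rewrite leNgt; apply/negP => hh; apply: nZ; right; right; left.
  by rewrite leNgt; apply/negP => hh; apply: nZ; right; right; right.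
have rE : r t = g t + b t by rewrite /g /b rM; case: ifP; rewrite ?addr0 ?add0r.
have [h1 _] := hZ1 t t01 n1; have [h2 h3] := hZ2 t t01 n2.
split.
  rewrite psumD (psum_supp _ pN1) ?leq_addr // (psum_supp _ p'N1) ?leq_addl // rE.
  rewrite opprD addrACA; apply: le_trans (ncD _ _) _.
  rewrite nc_distC [X in _ + X]nc_distC.
  have x1 : 2 * (e' / (16 * e)) * (2 * e) = e' / 4 by field; rewrite gt_eqF.
  have x2 : 2 * (e' / (16 * M)) * (2 * M) = e' / 4 by field; rewrite gt_eqF.
  by move: h1 h2; rewrite x1 x2; lra.
move=> re l; rewrite psumD; apply: le_trans (ncD _ _) _.
have bt0 : b t = 0 by rewrite /b re.
have := (pb l t).1; have := boundg t; have := (p'b l t).1.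
move: h3; rewrite bt0 subr0 => h3.
have : 2 * B' * nc (psum q' d' t) <= 2 * B' * nu by rewrite ler_wpM2l // mulr_ge0.
have : e <= B * e by rewrite ler_peMl // ltW.
rewrite -/B; lra.
Qed.

End CorrectionStep.

(** * Summation of the blocks *)

Section Iteration.
Variable R : realType.
Local Notation C := R[i].
Local Notation tau := (pi *+ 2 : R).

Lemma analytic_perturbation (f : R -> C) (eps : R) : borelC f -> 0 < eps ->
  exists c : int -> C, [/\
    exists2 Z : nat -> set R, (forall k, small (Z k) (10 * tau * 2^-1 ^+ k)) &
      forall (t : R) J, 0 <= t <= tau -> (forall j, (J <= j)%N -> ~ Z j t) ->
      forall eta : R, 0 < eta -> exists l0, forall l, (l0 <= l)%N ->
        nc (f t - psum c l t) <= eta,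
    forall l t, nc (psum (neg c) l t) <= eps
    & forall eta : R, 0 < eta -> exists l0, forall l t, (l0 <= l)%N ->
        nc (psum (neg c) l t - psum (neg c) l0 t) <= eta].
Proof.
move=> bf eps0; have t0 := tau_gt0 R.
(* The constants fit as follows: [5 (1 + L k) e k <= 160 e0 4^-k = a k], the sum of the [a k] is
   below [2 a 0 = 320 e0 = eps], and [76 * 2 tau / L k = 9.5 tau 2^-k]. *)
pose L (k : nat) := (16 * 2 ^ k)%N.
pose e0 := eps / 320.
have e00 : 0 < e0 by rewrite divr_gt0.
pose e (k : nat) : R := e0 * 8^-1 ^+ k.
pose a (k : nat) : R := 160 * e0 * 4^-1 ^+ k.
have e_gt0 k : 0 < e k by rewrite mulr_gt0 // exprn_gt0.
have a_gt0 k : 0 < a k by rewrite !mulr_gt0 // exprn_gt0.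
have aS k : a k.+1 = a k / 4 by rewrite /a exprSr mulrA.
have LRE k : (L k)%:R = 16 * 2 ^+ k :> R by rewrite natrM natrX.
have Le k : 5 * (1 + (L k)%:R) * e k <= a k.
  have -> : a k = 5 * (32 * 2 ^+ k) * e k.
    rewrite /a /e (_ : 4^-1 ^+ k = 2 ^+ k * 8^-1 ^+ k); last first.
      by rewrite -exprMn; congr (_ ^+ k); field.
    by ring.
  rewrite ler_wpM2r ?(ltW (e_gt0 k)) // LRE ler_wpM2l //.
  have : 1 <= 2 ^+ k :> R by rewrite exprn_ege1 // ler1n.
  by lra.
have ea k : e k <= a k.
  apply: le_trans (Le k); rewrite ler_peMl ?(ltW (e_gt0 k)) // LRE.
  have : 0 < 2 ^+ k :> R by rewrite exprn_gt0.
  by lra.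
have aK i j : (i <= j)%N -> a j <= a i.
  elim: j => [|j IH]; first by rewrite leqn0 => /eqP ->.
  rewrite leq_eqVlt => /predU1P[-> //|/IH ij]; rewrite aS.
  by have := a_gt0 j; lra.
pose P (x : nat * ((int -> C) * nat)) (y : ((int -> C) * nat) * set R) :=
  let k := x.1 in let c := x.2.1 in let N := x.2.2 in
  let p := y.1.1 in let N1 := y.1.2 in
  [/\ supp p N1, forall n, (`|n| <= N)%N -> p n = 0,
    forall l t, nc (psum (neg p) l t) <= a k, small y.2 (10 * tau * 2^-1 ^+ k)
    & forall t : R, 0 <= t <= tau -> ~ y.2 t ->
      nc (f t - psum c N t - psum p N1 t) <= e k.+1 /\
      (nc (f t - psum c N t) <= e k -> forall l, nc (psum p l t) <= 2 * a k)].
have /choice[S hS] : forall x, exists y, P x y.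
  move=> [k [c N]].
  have br : borelC (fun t => f t - psum c N t).
    by apply: borelC_sub => //; apply: contC_borel; apply: contC_psum.
  have L4 : (4 <= L k)%N by rewrite /L; have := expn_gt0 2 k; lia.
  have [p [N1 [pN1 pN pb [Z sZ hZ]]]] := correction_step N br L4 (e_gt0 k) (e_gt0 k.+1).
  exists (p, N1, Z); split => //=.
  - by move=> l t; apply: le_trans (pb l t) (Le k).
  - apply: small_le sZ; rewrite LRE -[_ *+ 2]mulr_natr exprVn.
    have p0 : 0 < 2 ^+ k :> R by rewrite exprn_gt0.
    have : 0 < tau / 2 ^+ k by rewrite divr_gt0.
    rewrite [tau / (16 * _)](_ : _ = tau / 2 ^+ k / 16); last first.
      by move: tau => T; field; rewrite gt_eqF.
    by rewrite -[leRHS]mulrA; move: (tau / _) => y y0; lra.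
  move=> t t01 nZ; have [h1 h2] := hZ t t01 nZ; split => // re l.
  by apply: le_trans (h2 re l) _; have := Le k; have := a_gt0 k; lra.
(* The successor makes the levels strictly increasing, so that they exhaust all frequencies even if
   a block is zero. *)
pose stp (k : nat) (s : (int -> C) * nat) : (int -> C) * nat :=
  let y := S (k, s) in (fun n => s.1 n + y.1.1 n, (y.1.2 + s.2).+1).
pose st := fix st k := if k is j.+1 then stp j (st j) else ((fun=> 0) : int -> C, 0%N).
pose c k := (st k).1; pose N k := (st k).2.
pose p k := (S (k, st k)).1.1; pose Z k := (S (k, st k)).2.
have cS k n : c k.+1 n = c k n + p k n by [].
have NS k : (N k < N k.+1)%N by rewrite /N /= ltnS leq_addl.
have pN k : supp (p k) (N k.+1).
  have [h _ _ _ _] := hS (k, st k); apply: supp_le h.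
  by rewrite /N /=; rewrite -addSn ltnW // ltnS leq_addr.
have pN0 k n : (`|n| <= N k)%N -> p k n = 0 by have [_ h _ _ _] := hS (k, st k); apply: h.
have Nmono i j : (i <= j)%N -> (N i <= N j)%N.
  elim: j => [|j IH]; first by rewrite leqn0 => /eqP ->.
  rewrite leq_eqVlt => /predU1P[-> //|ij]; apply: leq_trans (IH ij) _.
  exact: ltnW (NS j).
have Nge k : (k <= N k)%N by elim: k => // k IH; exact: leq_ltn_trans IH (NS k).
have cN k : supp (c k) (N k).
  elim: k => [//|k IH] n nN; rewrite cS pN // IH ?addr0 //.
  exact: ltn_trans (NS k) nN.
have stable i j n : (i <= j)%N -> (`|n| <= N i)%N -> c j n = c i n.
  move=> + ni; elim: j => [|j IH]; first by rewrite leqn0 => /eqP ->.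
  rewrite leq_eqVlt => /predU1P[-> //|ij].
  by rewrite cS IH // pN0 ?addr0 // (leq_trans ni) // Nmono.
(* Later blocks leave frequencies up to [N k] unchanged, and [k <= N k]; the coefficient at [n] is
   therefore final at stage [|n|]. *)
pose cf (n : int) := c `|n|%N n.
have cfE k n : (`|n| <= N k)%N -> cf n = c k n.
  move=> nk; rewrite /cf; have [h|h] := leqP `|n| k.
    by rewrite (stable _ _ _ h) // Nge.
  by rewrite (stable _ _ _ (ltnW h)).
have psum_cf k l t : (N k <= l <= N k.+1)%N ->
    psum cf l t = psum (c k) (N k) t + psum (p k) l t.
  move=> /andP[kl lk]; rewrite -(psum_supp t (cN k) kl) -psumD.
  by apply: eq_ssum => n nl; rewrite (cfE k.+1) // (leq_trans nl).
have psum_ncf k l t : (N k <= l <= N k.+1)%N ->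
    psum (neg cf) l t = psum (neg cf) (N k) t + psum (neg (p k)) l t.
  move=> /andP[kl lk].
  rewrite [psum (neg cf) (N k) t](_ : _ = psum (neg (c k)) (N k) t); last first.
    by apply: eq_ssum => n nl; rewrite /neg; case: ifP => // _; rewrite (cfE k).
  rewrite -(psum_supp t (neg_supp (cN k)) kl) -psumD.
  apply: eq_ssum => n nl; rewrite /neg; case: ifP => _; last by rewrite addr0.
  by rewrite (cfE k.+1) // (leq_trans nl).
have between K l : (N K <= l)%N -> exists2 k, (K <= k)%N & (N k <= l <= N k.+1)%N.
  move=> Kl; have H : exists k, (l <= N k.+1)%N by exists l; rewrite (leq_trans (Nge l)) // ltnW.
  case: (ex_minnP H) => k lk kmin; have [Kk|kK] := leqP K k.
    exists k => //; rewrite lk andbT; case: k lk kmin Kk => [|k] lk kmin Kk.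
      by move: Kk; rewrite leqn0 => /eqP K0; rewrite -K0.
    by rewrite leqNgt; apply/negP => lk'; have := kmin k (ltnW lk'); rewrite ltnn.
  by exists K => //; rewrite Kl (leq_trans lk) // Nmono // ltnW.
(* The bound telescopes: [a k <= 2 a k - 2 a k.+1], because [a] decays by the factor [4]. *)
have neg_diff K k l t : (K <= k)%N -> (N K <= l <= N k)%N ->
    nc (psum (neg cf) l t - psum (neg cf) (N K) t) <= 2 * a K - 2 * a k.
  elim: k l => [|k IH] l.
    rewrite leqn0 => /eqP -> /andP[l1 l2]; rewrite (_ : l = N 0%N); last by apply/eqP; rewrite eqn_leq l2.
    by rewrite !subrr nc0.
  rewrite leq_eqVlt => /predU1P[-> /andP[l1 l2]|Kk].
    by rewrite (_ : l = N k.+1) ?subrr ?nc0 //; apply/eqP; rewrite eqn_leq l2.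
  rewrite aS => /andP[l1 l2]; have [lk|lk] := leqP l (N k).
    apply: le_trans (IH l Kk _) _; first by rewrite l1.
    by have := a_gt0 k; lra.
  rewrite (psum_ncf k) ?l2 ?(ltnW lk) // addrAC; apply: le_trans (ncD _ _) _.
  have := IH (N k) Kk; rewrite leqnn Nmono // => /(_ isT) h1.
  have h2 : nc (psum (neg (p k)) l t) <= a k by have [_ _ h _ _] := hS (k, st k); apply: h.
  by have := a_gt0 k; lra.
have neg_diff2 K l t : (N K <= l)%N ->
    nc (psum (neg cf) l t - psum (neg cf) (N K) t) <= 2 * a K.
  move=> Kl; have [k Kk /andP[_ lk]] := between K l Kl.
  apply: le_trans (neg_diff K k.+1 l t _ _) _; rewrite ?(leqW Kk) ?Kl //.
  by have := a_gt0 k.+1; lra.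
have a_small (eta : R) : 0 < eta -> exists K, 3 * a K <= eta.
  move=> eta0.
  have q4 : 0 <= (4^-1 : R) < 1 by apply/andP; split; lra.
  have eta3 : 0 < eta / (3 * (160 * e0)) by rewrite divr_gt0 // !mulr_gt0.
  have [n hn] := exp_small q4 eta3.
  by exists n; rewrite /a mulrA mulrC -ler_pdivlMr // !mulr_gt0.
exists cf; split.
- exists Z; first by move=> k; have [_ _ _ h _] := hS (k, st k).
  move=> t J t01 good eta eta0; have [K hK] := a_small eta eta0.
  exists (N (maxn J K).+1) => l Kl; have [k Kk lk] := between _ _ Kl.
  case: k Kk lk => // k Kk lk; rewrite ltnS geq_max in Kk; case/andP: Kk => Jk Kk.
  (* Two consecutive steps are used: step [k] brings the remainder below [e k.+1], the threshold
     under which step [k.+1] has small partial sums. *)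
  have [_ _ _ _ /(_ t t01 (good k Jk)) [h1 _]] := hS (k, st k).
  have [_ _ _ _ /(_ t t01 (good k.+1 (leqW Jk))) [_ h2]] := hS (k.+1, st k.+1).
  have r1 : nc (f t - psum (c k.+1) (N k.+1) t) <= e k.+1.
    have -> : psum (c k.+1) (N k.+1) t = psum (c k) (N k) t + psum (p k) (N k.+1) t.
      by rewrite -(psum_supp t (cN k) (ltnW (NS k))) -psumD.
    rewrite opprD addrA.
    have [h _ _ _ _] := hS (k, st k).
    rewrite (psum_supp t h); first exact: h1.
    by rewrite /N /= -addSn ltnW // ltnS leq_addr.
  have h3 := h2 r1 l.
  rewrite (psum_cf k.+1) // opprD addrA; apply: le_trans (ncB _ _) _.
  by have := aK K k.+1 (leqW Kk); have := ea k.+1; lra.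
(* Level [0] is frequency [0], where the negative part is empty, so the difference is the full
   partial sum, at most [2 a 0 = eps]. *)
- move=> l t; have := @neg_diff2 0%N l t isT.
  rewrite [psum (neg cf) (N 0%N) t]psum_eq0 ?subr0.
    move=> /le_trans; apply; rewrite /a expr0 mulr1 /e0; lra.
  by move=> n; rewrite leqn0 absz_eq0 => /eqP ->.
- move=> eta eta0; have [K hK] := a_small eta eta0.
  exists (N K) => l t Kl; apply: le_trans (neg_diff2 K l t Kl) _.
  by have := a_gt0 K; lra.
Qed.

End Iteration.

(** * Null sets: countable unions, translations, periodicity *)

Section AlmostEverywhere.
Variable R : realType.
Local Notation C := R[i].
Local Notation tau := (pi *+ 2 : R).

Lemma small_eps (A : set R) : (forall e : R, 0 < e -> small A e) -> small A 0.
Proof. by move=> sA; apply/lee_addgt0Pr => e e0; rewrite add0e; exact: sA. Qed.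

Lemma small_bigcup (F : nat -> set R) (e : R) : 0 <= e ->
  (forall i, small (F i) (e / (2 ^ i.+1)%:R)) -> small (\bigcup_i F i) e.
Proof.
move=> e0 sF; apply: le_trans (outer_measure_sigma_subadditive _ _) _.
apply: le_trans (epsilon_trick0 xpredT e0); apply: lee_nneseries => [k _ _|k _].
  exact: outer_measure_ge0.
exact: sF.
Qed.

Lemma small0_bigcup (F : nat -> set R) : (forall i, small (F i) 0) -> small (\bigcup_i F i) 0.
Proof. by move=> sF; apply: small_bigcup => // i; rewrite mul0r. Qed.

(** Outer measure is computed by covers with open intervals, and translation preserves their
    lengths. *)
Lemma small0_shift (A : set R) (a : R) : small A 0 -> small [set t | A (t - a)] 0.
Proof.
move=> sA; apply: small_eps => e e0.
have A0 : ((@wlength R idfun)^*)%mu A = 0%E by apply/eqP; rewrite eq_le outer_measure_ge0 andbT; exact: sA.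
have [F [oF AF] Fe] : exists2 I_, open_itv_cover A I_ &
    (\sum_(0 <= k <oo) @wlength R idfun (I_ k) <= e%:E)%E.
  have : ((@wlength R idfun)^*)%mu A \is a fin_num by rewrite A0.
  rewrite outer_measure_open_itv_cover.
  move=> /lb_ereal_inf_adherent-/(_ _ e0)[_/= [F]] AF <-.
  rewrite -outer_measure_open_itv_cover A0 add0e => Fe.
  by exists F => //; exact/ltW.
apply: le_trans Fe.
apply: (@le_trans _ _ (((@wlength R idfun)^*)%mu (\bigcup_k [set t | F k (t - a)]))).
  by apply: le_outer_measure => t /AF[k _ Fk]; exists k.
apply: le_trans (outer_measure_sigma_subadditive _ _) _.
apply: lee_nneseries => [k _ _|k _]; first exact: outer_measure_ge0.
have [[x y] /= FE] := oF k.
rewrite FE (_ : [set t | _] = `]x + a, y + a[%classic).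
  have -> : @wlength R idfun `]x, y[ = lebesgue_measure (`]x + a, y + a[%classic : set R).
    rewrite lebesgue_measure_itv wlength_itv /= !lte_fin ltrD2r -!EFinD.
    by case: ifP => // _; rewrite opprD addrACA subrr addr0.
  exact: lexx.
by apply/seteqP; split => t /=; rewrite !in_itv /= ltrBlDr ltrBrDr.
Qed.

Lemma periodic_int (V : Type) (g : R -> V) t (p : int) :
  (forall t, g (t + tau) = g t) -> g (t + p%:~R * tau) = g t.
Proof.
move=> gP; have h (n : nat) s : g (s + n%:R * tau) = g s.
  elim: n => [|n IH]; first by rewrite mul0r addr0.
  by rewrite -addn1 natrD mulrDl mul1r addrA gP IH.
case: p => n; first exact: h.
by rewrite NegzE mulrNz mulNr -[in RHS](subrK (n.+1%:R * tau) t) h.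
Qed.

(** Reduction modulo [tau] covers [B] by countably many translates of [A]; [F n] collects the two by
    [n] periods in either direction. *)
Lemma small0_periodize (A : set R) (B : set R) :
  (forall t, 0 <= t <= tau -> B t -> A t) -> (forall t, B (t + tau) = B t) ->
  small A 0 -> small B 0.
Proof.
move=> BA Bper sA; have t0 := tau_gt0 R.
pose F (n : nat) := [set t | A (t - n%:R * tau)] `|` [set t | A (t - (- (n%:R * tau)))].
have sF n : small (F n) 0.
  by rewrite -[0]addr0; apply: smallU; exact: small0_shift.
apply: small_sub (small0_bigcup sF) => t Bt.
pose p := Num.floor (t / tau).
have As : A (t - p%:~R * tau).
  apply: BA; last by rewrite -mulNr -rmorphN /= (periodic_int _ _ Bper).
  have := floor_itv (t / tau); rewrite -/p => /andP[p1 p2].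
  have e : t = t / tau * tau by rewrite divfK // gt_eqF.
  move: p1 p2; rewrite -(ler_pM2r t0) -(ltr_pM2r t0) -e intrD mulrDl mul1r => p1 p2.
  by apply/andP; split; lra.
exists (absz p) => //; case: p As => n; first by left.
by rewrite NegzE mulrNz mulNr => As; right.
Qed.

Lemma negligible_small (A : set R) : small A 0 -> (@completed_lebesgue_measure R).-negligible A.
Proof.
move=> sA; have A0 : ((@wlength R idfun)^*)%mu A = 0%E.
  by apply/eqP; rewrite eq_le outer_measure_ge0 andbT; exact: sA.
have /negligible_outer_measure[B [mB B0 AB]] := A0.
by exists B; split => //; exact: sub_caratheodory.
Qed.

End AlmostEverywhere.

(** * Fourier coefficients of a uniform limit *)

Section FourierCoefficients.
Variable R : realType.
Local Notation C := R[i].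
Local Notation tau := (pi *+ 2 : R).

Let A : set R := `[0, tau].
Let mu := @lebesgue_measure R.

Definition cint (u : R -> R) : R := Rintegral mu A u.

Let mA : measurable A. Proof. exact: measurable_itv. Qed.

Let muA : mu A = tau%:E.
Proof. by rewrite /mu /A lebesgue_measure_itv /= lte_fin tau_gt0 oppr0 addr0. Qed.

Let cintble (u : R -> R) : continuous u -> mu.-integrable A (EFin \o u).
Proof.
move=> cu; apply: continuous_compact_integrable; first exact: segment_compact.
exact: continuous_subspaceT.
Qed.

(** The identity pushes the completed measure forward to Lebesgue measure on Borel sets. This makes
    the fundamental theorem of calculus applicable to the integrals in [fourier_coef]. *)
Lemma Rintegral_completed (u : R -> R) : continuous u ->
  Rintegral (@completed_lebesgue_measure R) A u = cint u.
Proof.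
move=> cu; congr fine.
have mid : measurable_fun [set: lebesgueType R] (idfun : lebesgueType R -> measurableTypeR R).
  by move=> _ Y mY; rewrite setTI; exact: sub_caratheodory.
pose nu := pushforward (@completed_lebesgue_measure R) (idfun : lebesgueType R -> measurableTypeR R).
transitivity (\int[nu]_(x in A) (u x)%:E)%E; last first.
  by apply: eq_measure_integral => B mB _.
symmetry; apply: (integral_pushforward mid) => //.
  by apply/measurable_EFinP; exact: continuous_measurable_fun.
have mA' : measurable (A : set (lebesgueType R)) by exact: sub_caratheodory.
apply: measurable_bounded_integrable => //.
- by apply: (@le_lt_trans _ _ (mu A)); [exact: lexx | rewrite muA ltry].
- move=> _ Y mY; apply: measurableI => //.
  have := @continuous_measurable_fun R u cu measurableT Y mY; rewrite setTI.
  exact: sub_caratheodory.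
have /compact_bounded [M [Mr hM]] :=
  continuous_compact (continuous_subspaceT (A := A) cu) (@segment_compact R 0 tau).
by exists M; split => // x Mx t At; apply: (hM x Mx); exists t.
Qed.

Lemma cint_dist (u v : R -> R) (eta : R) : continuous u -> continuous v ->
  (forall t, `|u t - v t| <= eta) -> `|cint u - cint v| <= eta * tau.
Proof.
move=> cu cv uv.
have cuv : continuous (fun t => u t - v t).
  by move=> t; apply: (@cvgB _ R^o); [exact: cu | exact: cv].
rewrite /cint -RintegralB ?cintble //.
have h := @le_normr_Rintegral _ _ _ mu A _ mA (cintble cuv).
apply: le_trans h _.
have -> : eta * tau = \int[mu]_(x in A) eta by rewrite Rintegral_cst //; congr (_ * _); exact: (esym (congr1 fine muA)).
apply: le_Rintegral => //.
- by apply: cintble => t; apply: (@cvg_norm _ R^o); exact: cuv.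
- by apply: cintble => t; exact: cvg_cst.
Qed.

Lemma cint_trig (k : int) : k != 0 ->
  cint (fun t => cos (k%:~R * t)) = 0 /\ cint (fun t => sin (k%:~R * t)) = 0.
Proof.
move=> k0; have kR : (k%:~R : R) != 0 by rewrite intr_eq0.
have ck : continuous (fun t : R => k%:~R * t).
  by move=> t; apply: cvgM; [exact: cvg_cst | exact: cvg_id].
have [c1 c2] : continuous (fun t : R => cos (k%:~R * t)) /\
               continuous (fun t : R => sin (k%:~R * t)).
  by have [] := @contC_ex R k.
have dl (x : R) : is_derive x (1 : R) (fun t : R => k%:~R * t : R) (k%:~R * 1).
  have H := is_deriveZ k%:~R (is_derive_id x (1 : R)).
  exact: H.
have d1 (x : R) : is_derive x (1 : R) (fun t : R => k%:~R^-1 * sin (k%:~R * t) : R) (cos (k%:~R * x)).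
  have H := is_deriveZ k%:~R^-1 (is_derive1_comp (is_derive_sin (k%:~R * x)) (dl x)).
  rewrite (_ : cos (k%:~R * x) = k%:~R^-1 * (cos (k%:~R * x) * (k%:~R * 1))); first exact: H.
  by field.
have d2 (x : R) : is_derive x (1 : R) (fun t : R => - k%:~R^-1 * cos (k%:~R * t) : R) (sin (k%:~R * x)).
  have H := is_deriveZ (- k%:~R^-1) (is_derive1_comp (is_derive_cos (k%:~R * x)) (dl x)).
  rewrite (_ : sin (k%:~R * x) = - k%:~R^-1 * (- sin (k%:~R * x) * (k%:~R * 1))); first exact: H.
  by field.
have ftc (G g : R -> R) : continuous g -> (forall x : R, is_derive x (1 : R) G (g x)) ->
    cint g = G tau - G 0.
  move=> cg dG; have cG : continuous G.
    move=> x; apply/differentiable_continuous/derivable1_diffP.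
    by have [] := dG x.
  rewrite /cint /Rintegral (@continuous_FTC2 _ g G) ?tau_gt0 //.
  - exact: continuous_subspaceT.
  - split => [x _||]; first by have [] := dG x.
      exact/cvg_at_right_filter/cG.
    exact/cvg_at_left_filter/cG.
  - by move=> x _; rewrite derive1E; have [] := dG x.
have /(congr1 (fun z : C => (complex.Re z, complex.Im z))) /= [e1 e2] := @ex_pi2 R k.
split.
  by rewrite (ftc _ _ c1 d1) e2 !mulr0 sin0 mulr0 subrr.
by rewrite (ftc _ _ c2 d2) e1 mulr0 cos0 subrr.
Qed.



Lemma cintD (u v : R -> R) : continuous u -> continuous v ->
  cint (fun t => u t + v t) = cint u + cint v.
Proof. by move=> cu cv; rewrite /cint RintegralD ?cintble. Qed.

Lemma cintZ (a : R) (u : R -> R) : continuous u -> cint (fun t => a * u t) = a * cint u.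
Proof. by move=> cu; rewrite /cint RintegralZl ?cintble. Qed.

Definition cintC (w : R -> C) : C :=
  Complex (cint (fun t => complex.Re (w t))) (cint (fun t => complex.Im (w t))).

Lemma cintC_add (v w : R -> C) : contC v -> contC w ->
  cintC (fun t => v t + w t) = cintC v + cintC w.
Proof.
move=> [v1 v2] [w1 w2]; rewrite /cintC; congr Complex.
  by rewrite -cintD //; congr cint; apply/funext => t; rewrite ReD.
by rewrite -cintD //; congr cint; apply/funext => t; rewrite ImD.
Qed.

Lemma cintC_ex (a : C) (k : int) : cintC (fun t => a * ex k t) = (k == 0)%:R * (tau%:C%C * a).
Proof.
have cst (b : R) : cint (fun=> b) = b * tau.
  by rewrite /cint Rintegral_cst //; congr (_ * _); exact: (congr1 fine muA).
have [->|k0] := eqVneq k 0.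
  rewrite mul1r /cintC (_ : (fun t => complex.Re _) = fun=> complex.Re a); last first.
    by apply/funext => t; rewrite ex0 mulr1.
  rewrite (_ : (fun t => complex.Im _) = fun=> complex.Im a); last first.
    by apply/funext => t; rewrite ex0 mulr1.
  rewrite !cst; case: a => x y /=; rewrite [RHS]/GRing.mul /=; congr Complex; ring.
have [c s] := cint_trig k0; have [kc ks] := @contC_ex R k.
have mulc (b : R) (u : R -> R) : continuous u -> continuous (fun t => b * u t).
  by move=> cu t; apply: cvgM; [exact: cvg_cst | exact: cu].
rewrite mul0r /cintC; case: a => x y /=.
rewrite (_ : (fun t => x * _ - y * _) =
  fun t => x * cos (k%:~R * t) + (- y) * sin (k%:~R * t)); last first.
  by apply/funext => t; rewrite mulNr.
by rewrite !cintD ?cintZ ?c ?s ?mulr0 ?addr0 //; apply: mulc.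
Qed.

Lemma cintC_psum (b : int -> C) (n : int) l : (`|n| <= l)%N ->
  cintC (fun t => psum b l t * ex (- n) t) = tau%:C%C * b n.
Proof.
move=> nl; rewrite -(ssum_delta (fun k => tau%:C%C * b k) nl) {nl}.
have termE k t : b k * ex k t * ex (- n) t = b k * ex (k - n) t.
  by rewrite exD mulrA.
have cterm k : contC (fun t => b k * ex (k - n) t).
  by apply: contC_mul; [exact: contC_cst | exact: contC_ex].
have delta k : cintC (fun t => b k * ex (k - n) t) = (n == k)%:R * (tau%:C%C * b k).
  by rewrite cintC_ex subr_eq0 eq_sym.
have cpsum l' : contC (fun t => psum b l' t * ex (- n) t).
  by apply: contC_mul; [exact: contC_psum | exact: contC_ex].
elim: l => [|l IH].
  rewrite ssum0 -delta; congr cintC; apply/funext => t.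
  by rewrite /psum ssum0 termE.
rewrite ssumS -IH -!delta -!cintC_add //; last first.
  by apply: contC_add.
congr cintC; apply/funext => t; rewrite /psum ssumS !mulrDl !termE.
by congr (_ + _ + _).
Qed.

Lemma cintC_dist (v w : R -> C) (eta : R) : contC v -> contC w ->
  (forall t, nc (v t - w t) <= eta) -> nc (cintC v - cintC w) <= 2 * (eta * tau).
Proof.
move=> [v1 v2] [w1 w2] vw; apply: le_trans (nc_le_ReIm _) _.
rewrite mulr_natl mulr2n; apply: lerD; apply: cint_dist => // t.
  by apply: le_trans (vw t); rewrite -ReB; apply: nc_Re.
by apply: le_trans (vw t); rewrite -ImB; apply: nc_Im.
Qed.

Lemma contC_uniform_limit (b : int -> C) (F : R -> C) :
  (forall eta : R, 0 < eta -> exists l, forall t, nc (psum b l t - F t) <= eta) -> contC F.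
Proof.
move=> bF.
have H (p : C -> R) : (forall x y, `|p x - p y| <= nc (x - y)) ->
    (forall l, continuous (fun t => p (psum b l t))) -> continuous (fun t => p (F t)).
  move=> pL cp t; apply/cvgrPdist_le => e e0.
  have e3 : 0 < e / 3 by rewrite divr_gt0.
  have [l hl] := bF _ e3.
  have /cvgrPdist_le /(_ _ e3) := cp l t.
  apply: filterS => s hs.
  have h1 := le_trans (pL _ _) (hl t); have h2 := le_trans (pL _ _) (hl s).
  rewrite (_ : p (F t) - p (F s) = - (p (psum b l t) - p (F t)) +
     (p (psum b l t) - p (psum b l s)) + (p (psum b l s) - p (F s))); last by ring.
  rewrite (le_trans (ler_normD _ _)) // (le_trans (lerD (ler_normD _ _) (lexx _))) //.
  by rewrite normrN; move: h1 h2 hs => /= h1 h2 hs; lra.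
have cps l := @contC_psum R b l.
split.
  apply: (H (@complex.Re R)) => [x y|l]; last by have [] := cps l.
  by rewrite -ReB nc_Re.
apply: (H (@complex.Im R)) => [x y|l]; last by have [] := cps l.
by rewrite -ImB nc_Im.
Qed.

(** By orthogonality the [n]-th integral of a partial sum is exactly [tau * b n] once [l >= |n|],
    and integration over a bounded interval respects uniform limits. *)
Lemma fourier_coef_uniform_limit (b : int -> C) (F : R -> C) n :
  (forall eta : R, 0 < eta -> exists l0, forall l t, (l0 <= l)%N ->
     nc (psum b l t - F t) <= eta) ->
  fourier_coef F n = b n.
Proof.
move=> bF; have t0 := tau_gt0 R.
have cF : contC F.
  by apply: (@contC_uniform_limit b) => eta /bF [l hl]; exists l => t; apply: hl.
have cG : contC (fun t => F t * ex (- n) t) by apply: contC_mul => //; exact: contC_ex.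
have E : cintC (fun t => F t * ex (- n) t) = tau%:C%C * b n.
  apply/eqP; rewrite -subr_eq0; apply/eqP/nc_eq0/eqP; rewrite eq_le nc_ge0 andbT.
  apply/ler_addgt0Pr => e e0; rewrite add0r.
  (* Integration multiplies the uniform error by [tau], and the componentwise estimate by [2]. *)
  have [l0 hl] := bF (e / (2 * tau)) (divr_gt0 e0 (mulr_gt0 (ltr0Sn _ 1) t0)).
  rewrite -(@cintC_psum b n (maxn l0 `|n|)) ?leq_maxr //.
  have -> : e = 2 * (e / (2 * tau) * tau) by move: tau t0 => T T0; field; rewrite gt_eqF.
  apply: cintC_dist => //.
    by apply: contC_mul; [exact: contC_psum | exact: contC_ex].
  move=> t; rewrite -mulrBl ncM nc_ex mulr1 nc_distC; apply: hl; exact: leq_maxl.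
have [g1 g2] := cG.
rewrite /fourier_coef -[RHS](mulKf (_ : tau%:C%C != 0 :> C)); last first.
  by apply/eqP => /complexI h; move: t0; rewrite h ltxx.
rewrite -E -fmorphV; congr (_ * _).
by rewrite /cintC -(Rintegral_completed g1) -(Rintegral_completed g2).
Qed.

End FourierCoefficients.

(** * From epsilon estimates to the filters of the statement *)

Section Convergence.
Variable R : realType.
Local Notation C := R[i].
Local Notation tau := (pi *+ 2 : R).

(** Radii in [R[i]^o] are complex, but a positive one has zero imaginary part, so the comparison is
    a real one. *)
Lemma nc_lt_norm (z : C) (e : R[i]) : 0 < e -> nc z < complex.Re e -> `|z| < e.
Proof.
case: e => e1 e2; rewrite ltcE /= => /andP[/eqP -> _] h.
by rewrite (_ : `|z| = (nc z)%:C%C) // ltcR.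
Qed.

Lemma cvg_nc (u : nat -> R[i]^o) (z : R[i]^o) :
  (forall eta : R, 0 < eta -> exists l0, forall l, (l0 <= l)%N -> nc (z - u l : C) <= eta) ->
  u l @[l --> \oo] --> z.
Proof.
move=> H; apply/cvgrPdist_lt => e e0.
have e1 : 0 < complex.Re e by move: e0; rewrite ltcE => /andP[].
have [l0 hl] := H (complex.Re e / 2) (divr_gt0 e1 (ltr0Sn _ 1)).
exists l0 => // l /= l0l; apply: nc_lt_norm => //.
by apply: le_lt_trans (hl l l0l) _; rewrite ltr_pdivrMr // ltr_pMr // ltr1n.
Qed.

(** The rank [l0] and the rate are separated from the Cauchy hypothesis: with [l0] uniform in a
    parameter, pointwise limits become uniform. *)
Lemma cauchy_limit (u : nat -> R) :
  (forall eta : R, 0 < eta -> exists l0, forall l, (l0 <= l)%N -> `|u l - u l0| <= eta) ->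
  forall (eta : R) l0, 0 < eta -> (forall l, (l0 <= l)%N -> `|u l - u l0| <= eta) ->
  forall l, (l0 <= l)%N -> `|limn u - u l| <= 3 * eta.
Proof.
move=> uC eta l0 eta0 hu l l0l.
have cu : cvgn u.
  apply/cauchy_cvgP/cauchy_exP => e e0.
  have [k hk] := uC (e / 2) (divr_gt0 e0 (ltr0Sn _ 1)).
  exists (u k), k => // j kj; rewrite /ball /= distrC.
  by apply: le_lt_trans (hk j kj) _; rewrite ltr_pdivrMr // ltr_pMr // ltr1n.
have /cvgrPdist_le /(_ _ eta0) [k _ hk] := cu.
have h1 := hk (maxn k l0) (leq_maxl _ _).
have h2 := hu (maxn k l0) (leq_maxr _ _); have h3 := hu l l0l.
rewrite (_ : limn u - u l = (limn u - u (maxn k l0)) + (u (maxn k l0) - u l0) + (u l0 - u l));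
  last by ring.
rewrite (le_trans (ler_normD _ _)) // (le_trans (lerD (ler_normD _ _) (lexx _))) //.
by rewrite [`|u l0 - _|]distrC; move: h1 h2 h3 => /= h1 h2 h3; lra.
Qed.

Lemma uniform_cvg_nc (u : nat -> R -> R[i]^o) (F : R -> R[i]^o) :
  (forall eta : R, 0 < eta -> exists l0, forall l t, (l0 <= l)%N ->
     nc (u l t - F t : C) <= eta) ->
  {uniform, u @ \oo --> F}.
Proof.
move=> uF P /uniform_nbhs[E [entE EP]].
move: entE; rewrite -entourage_ballE => -[e e0 heE].
have e1 : 0 < complex.Re e by move: e0; rewrite /= ltcE => /andP[].
have [l0 hl] := uF (complex.Re e / 2) (divr_gt0 e1 (ltr0Sn _ 1)).
exists l0 => // l /= l0l; apply: EP => t _; apply: heE => /=.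
rewrite -ball_normE /=; apply: nc_lt_norm => //; rewrite nc_distC.
by apply: le_lt_trans (hl l t l0l) _; rewrite ltr_pdivrMr // ltr_pMr // ltr1n.
Qed.

End Convergence.

Theorem theorem2 (R : realType) (f : R -> R[i]^o)
    (f_periodic : periodic f (pi *+ 2))
    (f_measurable : lebesgue_measurable_fun f)
    (eps : R) (eps_gt0 : 0 < eps) :
  exists (c : int -> R[i]^o) (fneg : R -> R[i]^o),
    [/\ {ae @completed_lebesgue_measure R, forall t,
          trig_partial_sum c N t @[N --> \oo] --> f t},
        {uniform, trig_partial_sum (negative_part c) @ \oo --> fneg}
      & (U_norm fneg < eps%:E)%E].
Proof.
have [m1 m2] := f_measurable.
have [u1 mu1 s1] := lebesgue_borel m1; have [u2 mu2 s2] := lebesgue_borel m2.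
pose f0 t : R[i] := Complex (u1 t) (u2 t).
have bf0 : borelC f0 by split.
have eps2 : 0 < eps / 2 by rewrite divr_gt0.
have [c [[Z sZ hZ] cneg ccauchy]] := analytic_perturbation bf0 eps2.
have t0 := tau_gt0 R.
pose good t := forall eta : R, 0 < eta -> exists l0, forall l, (l0 <= l)%N ->
  nc ((f t : R[i]) - psum c l t) <= eta.
have good_null : small [set t | ~ good t] 0.
  (* The upper limit of the exceptional sets, null by Borel-Cantelli. *)
  pose bad := \bigcap_J \bigcup_j Z (J + j)%N.
  have bad0 : small bad 0.
    apply: small_eps => e e0.
    have q2 : 0 <= (2^-1 : R) < 1 by apply/andP; split; lra.
    (* With [2^-J] below this, [10 tau 2^-J <= e / 2], which matches the weights [e / 2^(i+1)] of
       [small_bigcup]. *)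
    have w0 : 0 < e / (20 * (pi *+ 2)) by rewrite divr_gt0 // mulr_gt0.
    have [J hJ] := exp_small q2 w0.
    apply: (@small_sub _ _ (\bigcup_j Z (J + j)%N)); first exact: bigcap_inf.
    apply: small_bigcup; first exact: ltW.
    move=> i; apply: small_le (sZ _).
    have -> : e / (2 ^ i.+1)%:R = e * 2^-1 ^+ i / 2.
      by rewrite natrX exprVn exprS invfM mulrA mulrAC.
    have : 10 * (pi *+ 2) * 2^-1 ^+ J <= e / 2.
      move: hJ; rewrite ler_pdivlMr ?mulr_gt0 //; lra.
    have : 0 <= 2^-1 ^+ i :> R by rewrite exprn_ge0.
    rewrite exprD mulrA => y0 h; rewrite [leRHS]mulrAC.
    exact: ler_wpM2r.
  (* Convergence is known only on [[0, tau]]; failure of convergence is a periodic condition, since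
     [f] and all partial sums are periodic. *)
  apply: (@small0_periodize _ (bad `|` ([set t | u1 t <> complex.Re (f t)] `|`
                                        [set t | u2 t <> complex.Im (f t)]))).
  - move=> t t01 nt; apply: contrapT => h; apply: nt => eta eta0.
    have e1 : u1 t = complex.Re (f t).
      by apply: contrapT => h'; apply: h; right; left.
    have e2 : u2 t = complex.Im (f t).
      by apply: contrapT => h'; apply: h; right; right.
    have [J hJ] : exists J, forall j, (J <= j)%N -> ~ Z j t.
      have : ~ bad t by move=> h'; apply: h; left.
      move=> /existsNP[J /not_implyP[_ hJ]]; exists J => j Jj Zt; apply: hJ.
      by exists (j - J)%N => //; rewrite subnKC.
    have [l0 hl] := hZ t J t01 hJ eta eta0; exists l0 => l ll; have := hl l ll.
    by rewrite /f0 e1 e2; case: (f t).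
  - move=> t; apply/propext; rewrite /= /good f_periodic.
    suff per l : psum c l (t + pi *+ 2) = psum c l t.
      by split => h1 h2; apply: h1 => eta /h2 [l0 hl]; exists l0 => l ll;
        have := hl l ll; rewrite per.
    apply: eq_ssum => n _; congr (_ * _).
    by have := ex_periodic n t 1; rewrite mul1r.
  - by rewrite -[0]addr0 -[in X in small _ (_ + X)](addr0 0); do 2?[apply: smallU => //].
pose F t : R[i] := Complex (limn (fun l => complex.Re (psum (neg c) l t)))
                          (limn (fun l => complex.Im (psum (neg c) l t))).
have FE eta : 0 < eta -> exists l0, forall l t, (l0 <= l)%N ->
    nc (psum (neg c) l t - F t) <= eta.
  move=> eta0; have eta6 : 0 < eta / 6 by rewrite divr_gt0.
  have [l0 hl] := ccauchy _ eta6; exists l0 => l t ll.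
  have HR := @cauchy_limit R (fun l => complex.Re (psum (neg c) l t)).
  have HI := @cauchy_limit R (fun l => complex.Im (psum (neg c) l t)).
  have h1 : `|complex.Re (F t) - complex.Re (psum (neg c) l t)| <= 3 * (eta / 6).
    apply: (HR _ _ l0) => // [e e0|k kl]; last by rewrite -ReB (le_trans (nc_Re _)) // hl.
    have [k hk] := ccauchy _ e0; exists k => j kj.
    by rewrite -ReB (le_trans (nc_Re _)) // hk.
  have h2 : `|complex.Im (F t) - complex.Im (psum (neg c) l t)| <= 3 * (eta / 6).
    apply: (HI _ _ l0) => // [e e0|k kl]; last by rewrite -ImB (le_trans (nc_Im _)) // hl.
    have [k hk] := ccauchy _ e0; exists k => j kj.
    by rewrite -ImB (le_trans (nc_Im _)) // hk.
  rewrite nc_distC; apply: le_trans (nc_le_ReIm _) _; rewrite ReB ImB.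
  by move: h1 h2; lra.
exists c, F; split.
- apply: (negligibleS _ (negligible_small good_null)).
  by move=> t /= nc1 gt; apply: nc1; apply: cvg_nc.
- exact: (@uniform_cvg_nc R (trig_partial_sum (negative_part c))).
(* A supremum preserves only weak bounds; the margin [eps / 2] gives the strict inequality. *)
apply: (@le_lt_trans _ _ (eps / 2)%:E); last by rewrite lte_fin ltr_pdivrMr // ltr_pMr // ltr1n.
apply: ge_ereal_sup => _ [N _ <-]; apply: ge_ereal_sup => _ [t _ <-].
rewrite lee_fin (_ : trig_partial_sum _ N t = psum (neg c) N t); first exact: cneg.
(* The Fourier coefficients of the limit are those of the series, so its partial sums are the ones
   already bounded. *)
apply: (@eq_ssum R[i] (fun n => fourier_coef F n * ex n t) (fun n => neg c n * ex n t)).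
by move=> n _; rewrite (fourier_coef_uniform_limit n FE).
Qed.
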